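(* Let $A$ be a Banach algebra. Then the following statements are equivalent: (i) $\mathcal F(A)$ is Connes-amenable; (ii) for every contractive Banach $A$-bimodule $M$ and every derivation $D:A\to M$, the derivation $\eta_M D:A\to\mathcal F_A(M)$ is inner; (iii) every derivation from $A$ into a contractive, normal dual $\mathcal F(A)$-bimodule is inner.
   Context: All modules are Banach modules; all maps (including derivations) are linear and norm-continuous. An $A$-bimodule $X$ is contractive if $\|a\cdot x\|\le\|a\|\|x\|$ and $\|x\cdot a\|\le\|a\|\|x\|$. A derivation $D$ from $A$ to an $A$-bimodule satisfies $D(ab)=a\cdot D(b)+D(a)\cdot b$; it is inner if there is $n$ in the bimodule with $D(a)=a\cdot n-n\cdot a$ for all $a\in A$. The dual $X^*$ is an $A$-bimodule via $(a\cdot\phi)(x)=\phi(x\cdot a)$, $(\phi\cdot a)(x)=\phi(a\cdot x)$. For an $A$-bimodule $E$, $\mathrm{WAP}_A(E)$ is the closed sub-bimodule of all $x\in E$ for which the orbit maps $A\to E$, $a\mapsto a\cdot x$ and $a\mapsto x\cdot a$ are both weakly compact. Put $\mathcal F_A(X)_*=\mathrm{WAP}_A(X^* )$ and $\mathcal F_A(X)=(\mathcal F_A(X)_* )^*$, a dual $A$-bimodule. Let $\eta_X:X\to\mathcal F_A(X)$ be the canonical embedding $X\to X^{**}$ followed by the adjoint of the inclusion $\mathrm{WAP}_A(X^* )\hookrightarrow X^*$; it is an $A$-bimodule map. For $X=A$ write $\mathcal F(A)=\mathcal F_A(A)$ and $\mathcal F(A)_*=\mathrm{WAP}_A(A^*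 )$. $\mathcal F(A)$ carries the unique product for which the natural quotient map $A^{**}\to\mathcal F(A)$ is a homomorphism when $A^{**}$ has the first Arens product; this makes it a dual Banach algebra with predual $\mathcal F(A)_*$, and $\eta_A$ is a homomorphism. A Banach algebra $B$ is a dual Banach algebra with predual $B_*$ if $B_*\subseteq B^*$ is a closed sub-$B$-bimodule such that the natural map $B\to B^{**}\to(B_* )^*$ is bijective. A normal dual $B$-bimodule is the dual bimodule $M=(M_* )^*$ of a Banach $B$-bimodule $M_*$ such that for each $x\in M$ the maps $B\to M$, $b\mapsto b\cdot x$ and $b\mapsto x\cdot b$ are weak*-weak* continuous. $B$ is Connes-amenable if every weak*-weak* continuous derivation from $B$ to a normal dual $B$-bimodule is inner. Every $\mathcal F(A)$-bimodule is regarded as an $A$-bimodule via $\eta_A:A\to\mathcal F(A)$. *)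

(* Defs.v *)
From HB Require Import structures.
From mathcomp Require Import all_boot all_order all_algebra.
From mathcomp Require Import all_classical all_reals all_analysis.
From mathcomp Require Import complex.
Set Implicit Arguments.
Unset Strict Implicit.
Unset Printing Implicit Defensive.
Import Order.TTheory GRing.Theory Num.Theory.
Import numFieldNormedType.Exports.
Local Open Scope classical_set_scope.
Local Open Scope ring_scope.
Local Open Scope complex_scope.

(* Scalars are complex. Norms of normed modules over R[i] are R[i]-valued
   (and real), as always in MathComp-Analysis. *)

Section BoundedLinear.
Variable R : realType.
Local Notation C := R[i].
Implicit Types E G H : normedModType C.

Definition bounded_linear E G (T : E -> G) := linear T /\ continuous T.

Lemma bounded_linearP E G (T : E -> G) :
  bounded_linear T <->
  linear T /\ exists2 k : R, 0 < k & forall x, `|T x| <= k%:C * `|x|.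
Proof.
split=> [[lT cT]|[lT [k k0 Tk]]].
  split=> //; pose HT := GRing.isLinear.Build _ _ _ _ T lT.
  pose T' : {linear E -> G} := HB.pack T HT.
  have /linear_bounded_continuous/linear_boundedP : continuous T' by [].
  move=> /pinfty_ex_gt0[M M0 TM].
  have MR : (complex.Re M)%:C = M by apply: RRe_real; exact: gtr0_real.
  by exists (complex.Re M); [rewrite -ltcR MR|rewrite MR].
split=> //; pose HT := GRing.isLinear.Build _ _ _ _ T lT.
pose T' : {linear E -> G} := HB.pack T HT.
suff : continuous T' by [].
apply/linear_bounded_continuous/linear_boundedP.
exists k%:C; split; first by rewrite complex_real.
move=> r kr x; rewrite (le_trans (Tk x))// ler_wpM2r//.
exact: ltW.
Qed.

Lemma bounded_linear_of E G (T : E -> G) (k : R) :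
  linear T -> (forall x, `|T x| <= k%:C * `|x|) -> bounded_linear T.
Proof.
move=> lT Tk; apply/bounded_linearP; split=> //.
exists (`|k| + 1); first by rewrite ltr_wpDl.
move=> x; rewrite (le_trans (Tk x))// ler_wpM2r//.
by rewrite lecR (le_trans (ler_norm _))// lerDl.
Qed.

Lemma bounded_linear_comp E G H (S : G -> H) (T : E -> G) :
  bounded_linear S -> bounded_linear T -> bounded_linear (S \o T).
Proof.
move=> [lS cS] [lT cT]; split=> [a x y|x]; first by rewrite /= lT lS.
by apply: continuous_comp; [exact: cT|exact: cS].
Qed.

Definition rnorm E (x : E) : R := complex.Re `|x|.

Lemma rnormE E (x : E) : (rnorm x)%:C = `|x|.
Proof. by apply: RRe_real; exact: normr_real. Qed.

End BoundedLinear.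

Section Dual.
Variables (R : realType) (E : normedModType R[i]).
Local Notation C := R[i].

Definition functional : {pred E -> C^o} :=
  [pred f | `[< bounded_linear f >]].

Record dual := Dual { dual_fun :> E -> C^o; dual_funP : dual_fun \in functional }.

HB.instance Definition _ := [isSub for dual_fun].
HB.instance Definition _ := [Choice of dual by <:].

Lemma functional_submod : submod_closed functional.
Proof.
split=> [|a f g /asboolP/bounded_linearP[lf [k k0 fk]]].
  apply/asboolP/(@bounded_linear_of _ _ _ _ 0).
    by move=> a x y; apply/esym/eqP; rewrite addr_eq0 oppr0; exact/eqP/scaler0.
  by move=> x; rewrite normr0 mul0r.
move=> /asboolP/bounded_linearP[lg [l l0 gl]].
have aE z : (a *: f + g) z = a *: f z + g z by [].
apply/asboolP/(@bounded_linear_of _ _ _ _ (rnorm (a : C^o) * k + l)).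
  move=> b x y; rewrite aE lf lg !aE !scalerDr !addrA; congr (_ + _).
  by rewrite addrAC !scalerA mulrC.
move=> x; rewrite aE (le_trans (ler_normD _ _))// rmorphD mulrDl lerD//.
by rewrite normrZ rmorphM/= -mulrA (rnormE (a : C^o)) ler_wpM2l.
Qed.

HB.instance Definition _ :=
  GRing.isSubmodClosed.Build C (E -> C^o) functional functional_submod.
HB.instance Definition _ := [SubChoice_isSubLmodule of dual by <:].

Lemma dual_linear (f : dual) : linear f.
Proof. by have /asboolP[] := dual_funP f. Qed.

Lemma dual_continuous (f : dual) : continuous f.
Proof. by have /asboolP[] := dual_funP f. Qed.

Definition opnorm (f : dual) : R :=
  sup [set rnorm (f x) | x in [set x : E | `|x| <= 1]].

Let has_bound (f : dual) : exists2 k : R, 0 < k &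
  forall x, `|f x| <= k%:C * `|x|.
Proof. by have /asboolP/bounded_linearP[] := dual_funP f. Qed.

Let bounded_values (f : dual) :
  has_ubound [set rnorm (f x) | x in [set x : E | `|x| <= 1]].
Proof.
have [k k0 fk] := has_bound f; exists k => _ [y /= y1 <-].
by rewrite -lecR rnormE (le_trans (fk y))// ler_piMr// ler0c ltW.
Qed.

Lemma opnorm_le (f : dual) (k : R) : 0 <= k ->
  (forall x, `|f x| <= k%:C * `|x|) -> opnorm f <= k.
Proof.
move=> k0 fk; rewrite ge_sup//.
  by exists (rnorm (f 0)), 0 => //=; rewrite normr0.
move=> _ [x /= x1 <-]; rewrite -lecR rnormE (le_trans (fk x))//.
by rewrite ler_piMr// ler0c.
Qed.

Lemma le_opnorm (f : dual) x : `|f x| <= (opnorm f)%:C * `|x|.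
Proof.
have [->|x0] := eqVneq x 0.
  by have [k _ /(_ 0)] := has_bound f; rewrite normr0 !mulr0.
rewrite -ler_pdivrMr ?normr_gt0//.
have -> : `|f x| / `|x| = `|f (`|x|^-1 *: x)|.
  have /(_ (`|x|^-1) x 0) := dual_linear f.
  have f0 : f 0 = 0.
    by have /(_ (-1) 0 0) := dual_linear f; rewrite scaler0 addr0 scaleN1r addNr.
  by rewrite f0 !addr0 => ->; rewrite normrZ normfV normr_id mulrC.
rewrite -(rnormE (f _)) lecR; apply: ub_le_sup; first exact: bounded_values.
exists (`|x|^-1 *: x) => //.
by rewrite /= normrZ normfV normr_id mulVf ?normr_eq0.
Qed.

Lemma opnorm_ge0 (f : dual) : 0 <= opnorm f.
Proof.
apply: le_trans (_ : rnorm (f 0) <= _); first by rewrite -ler0c rnormE.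
apply: ub_le_sup; first exact: bounded_values.
by exists 0 => //=; rewrite normr0.
Qed.

Let norm (f : dual) : C := (opnorm f)%:C.

Let normD (f g : dual) : norm (f + g) <= norm f + norm g.
Proof.
rewrite /norm -rmorphD lecR; apply: opnorm_le => [|x].
  by rewrite addr_ge0// opnorm_ge0.
by rewrite rmorphD/= mulrDl (le_trans (ler_normD _ _))// lerD// le_opnorm.
Qed.

Let normZ_le (a : C) (f : dual) : norm (a *: f) <= `|a| * norm f.
Proof.
rewrite /norm -(rnormE (a : C^o)) -rmorphM lecR; apply: opnorm_le => [|x].
  by rewrite mulr_ge0// ?opnorm_ge0// -ler0c rnormE.
by rewrite rmorphM/= rnormE normrZ -mulrA ler_wpM2l// le_opnorm.
Qed.

Let normZ (a : C) (f : dual) : norm (a *: f) = `|a| * norm f.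
Proof.
apply/eqP; rewrite eq_le normZ_le/=.
have [->|a0] := eqVneq a 0; first by rewrite normr0 mul0r ler0c opnorm_ge0.
rewrite -ler_pdivlMl ?normr_gt0// -normfV.
by rewrite (le_trans _ (normZ_le _ _))// scalerA mulVf// scale1r.
Qed.

Let norm_eq0 (f : dual) : norm f = 0 -> f = 0.
Proof.
move=> f0; apply/val_inj/funext => x /=; apply/eqP.
by rewrite -normr_le0 (le_trans (le_opnorm f x))// -/(norm f) f0 mul0r.
Qed.

HB.instance Definition _ :=
  Lmodule_isNormed.Build C dual normD normZ norm_eq0.

Lemma dual_normE (f : dual) : `|f| = (opnorm f)%:C. Proof. by []. Qed.

End Dual.

Section SigmaTopology.
Variables (R : realType) (E : normedModType R[i]).
Local Notation C := R[i].

(* The topology sigma(E, P) for a set P of functionals on E. *)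
Definition sigma_topology (P : set (dual E)) :=
  initial_topology (fun (x : E) =>
    (fun phi : {phi | phi \in P} => sval phi x) : {ptws {phi | phi \in P} -> C^o}).

HB.instance Definition _ P := Uniform.on (sigma_topology P).

Definition weak := sigma_topology setT.
HB.instance Definition _ := Uniform.on weak.

Lemma sigma_eval_continuous (P : set (dual E)) (phi : dual E) : P phi ->
  continuous (fun x : sigma_topology P => phi x : C^o).
Proof.
move=> /mem_set Pphi; pose i : {phi | phi \in P} := exist _ phi Pphi.
have pc : continuous (fun f : {ptws {phi | phi \in P} -> C^o} => f i).
  exact: (@proj_continuous _ (fun=> C^o) i).
move=> y; have ic : continuous (fun x : sigma_topology P =>
    (fun phi => sval phi x) : {ptws {phi | phi \in P} -> C^o}).
  exact: initial_continuous.
exact: (continuous_comp (ic y) (pc _)).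
Qed.

Lemma continuous_to_sigma (Z : topologicalType) (P : set (dual E))
    (f : Z -> sigma_topology P) :
  (forall phi, P phi -> continuous (fun z => phi (f z) : C^o)) ->
  continuous f.
Proof.
move=> fP; apply: continuous_comp_initial => z; apply/cvg_sup => -[phi Pphi].
have Pphi' := set_mem Pphi.
move=> A /=; rewrite nbhs_simpl.
move=> [_ [[U oU <-] /= Uz UA]].
have : nbhs z ((fun z => phi (f z) : C^o) @^-1` U).
  by apply: fP => //; exact: open_nbhs_nbhs.
by apply: filterS => y; exact: UA.
Qed.

End SigmaTopology.

Lemma compact_closure_regular (T : topologicalType) (K : set T) :
  regular_space T -> compact K -> compact (closure K).
Proof.
move=> regT cK F PF FK.
pose G := filter_from [set U | open U /\ F U] (fun U => U `&` K).
have FG : Filter G.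
  apply: filter_from_filter; first by exists setT; split; [exact: openT|exact: filterT].
  move=> U V [oU FU] [oV FV]; exists (U `&` V).
    by split; [exact: openI|exact: filterI].
  by move=> x [[? ?] ?].
have PG : ProperFilter G.
  apply: filter_from_proper => U [oU FU].
  have [x [Ux Kx]] := filter_ex (filterI FU FK).
  have [y [Ky Uy]] := Kx U (open_nbhs_nbhs (conj oU Ux)).
  by exists y.
have [|y [Ky yG]] := cK G PG.
  by exists setT; [split; [exact: openT|exact: filterT]|move=> x []].
exists y; split; first exact: subset_closure.
move=> A V FA nV; apply: contrapT => AV.
have [W nW WV] := regT y V nV.
have oW : open (~` closure W) by apply: closed_openC; exact: closed_closure.
have FW : F (~` closure W).
  apply: filterS FA => x Ax Wx.
  by apply: AV; exists x; split=> //; exact: WV.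
have [|z [[Wz _] Wz']] := yG (~` closure W `&` K) W _ nW; first by exists (~` closure W).
by apply: Wz; exact: subset_closure.
Qed.

Lemma precompact_sub_compact (T : uniformType) (A K : set T) :
  A `<=` K -> compact K -> precompact A.
Proof.
move=> AK cK; apply: (precompact_subset AK); rewrite precompactE.
by apply: compact_closure_regular cK; exact: uniform_regular.
Qed.

Section WeaklyCompact.
Variable R : realType.
Local Notation C := R[i].
Implicit Types E G H : normedModType C.

(* Meant for linear T only: the image of the closed unit ball is relatively
   weakly compact. *)
Definition weakly_compact E G (T : E -> G) :=
  precompact (T @` [set x | `|x| <= 1] : set (weak G)).

Definition adjoint E G (T : E -> G) (bT : bounded_linear T) (phi : dual G) :
  dual E.
Proof.
refine (@Dual _ _ (fun x => phi (T x)) _).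
apply/asboolP; apply: (@bounded_linear_comp _ _ _ _ phi T) => //.
exact/asboolP/dual_funP.
Defined.

Lemma weak_continuous E G (T : E -> G) :
  bounded_linear T -> continuous (T : weak E -> weak G).
Proof.
move=> bT; apply: continuous_to_sigma => phi _.
exact: (@sigma_eval_continuous _ _ setT (adjoint bT phi)).
Qed.

Lemma weakly_compact_post E G H (S : G -> H) (T : E -> G) :
  bounded_linear S -> weakly_compact T -> weakly_compact (S \o T).
Proof.
move=> bS [K TK [cK _]]; apply: (@precompact_sub_compact (weak H) _ (S @` K)).
  by move=> _ [x x1 <-]; exists (T x) => //; apply: TK; exists x.
apply: continuous_compact cK; apply: continuous_subspaceT.
exact: weak_continuous.
Qed.

Lemma bounded_linear_scale E (a : C) : bounded_linear (fun x : E => a *: x).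
Proof.
apply: (@bounded_linear_of _ _ _ _ (rnorm (a : C^o))).
  by move=> b x y; rewrite scalerDr !scalerA mulrC.
by move=> x; rewrite normrZ rnormE.
Qed.

Lemma weakly_compact_pre E G H (T : G -> H) (S : E -> G) :
  linear T -> bounded_linear S -> weakly_compact T -> weakly_compact (T \o S).
Proof.
move=> lT /bounded_linearP[lS [k k0 Sk]] /(weakly_compact_post (bounded_linear_scale H k%:C)).
apply: precompact_subset => _ [x /= x1 <-].
have k0' : (k%:C : C) != 0 by rewrite gt_eqF// ltcR.
exists (k%:C^-1 *: S x) => /=.
  have kV : 0 <= (k%:C^-1 : C) by rewrite invr_ge0 ler0c ltW.
  rewrite normrZ (ger0_norm kV) ler_pdivrMl ?ltcR// mulr1 (le_trans (Sk x))//.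
  by rewrite ler_piMr// ler0c ltW.
have /(_ k%:C^-1 (S x) 0) := lT.
have T0 : T 0 = 0 by have /(_ (-1) 0 0) := lT; rewrite scaler0 addr0 scaleN1r addNr.
by rewrite T0 !addr0 => ->; rewrite scalerA mulfV// scale1r.
Qed.

Lemma weakly_compactD E G (S T : E -> G) : weakly_compact S ->
  weakly_compact T -> weakly_compact (fun x => S x + T x).
Proof.
move=> [K SK [cK _]] [L TL [cL _]].
apply: (@precompact_sub_compact (weak G) _ ((fun p : weak G * weak G => (p.1 : G) + p.2 : weak G) @` (K `*` L))).
  move=> _ [x x1 <-]; exists (S x, T x) => //; split=> /=.
    by apply: SK; exists x.
  by apply: TL; exists x.
apply: continuous_compact; last exact: compact_setX.
apply: continuous_subspaceT; apply: continuous_to_sigma => phi _ [x y].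
have -> : (fun z : weak G * weak G => phi ((z.1 : G) + z.2)) =
  (fun z => (phi z.1 : C^o) + phi z.2).
  apply/funext => z; have /(_ 1 z.1 z.2) := dual_linear phi.
  by rewrite !scale1r.
have ec := @sigma_eval_continuous _ _ setT phi I.
have ex : {for (x, y), continuous (fun z : weak G * weak G => phi z.1 : C^o)}.
  exact: (@cvg_comp _ _ _ fst (fun x : weak G => phi x : C^o) _ _ _ cvg_fst (ec x)).
have ey : {for (x, y), continuous (fun z : weak G * weak G => phi z.2 : C^o)}.
  exact: (@cvg_comp _ _ _ snd (fun x : weak G => phi x : C^o) _ _ _ cvg_snd (ec y)).
exact: (continuousD ex ey).
Qed.

Lemma weakly_compact0 E G : weakly_compact (fun _ : E => 0 : G).
Proof.
apply: (@precompact_sub_compact (weak G) _ [set (0 : weak G)]).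
  by move=> _ [x _ <-].
exact: compact_set1.
Qed.

End WeaklyCompact.

Section Bimodules.
Variable R : realType.
Local Notation C := R[i].

Record banachAlgebra := BanachAlgebra {
  ba_space :> completeNormedModType C;
  ba_mul : ba_space -> ba_space -> ba_space;
  ba_mul_linearr : forall a, linear (ba_mul a);
  ba_mul_linearl : forall b, linear (ba_mul^~ b);
  ba_mulA : associative ba_mul;
  ba_norm_mul : forall a b, `|ba_mul a b| <= `|a| * `|b| }.

(* Bimodule structures on E over the algebra (B, mul). The product is passed
   unbundled because the algebra axioms of the enveloping algebra below are
   not needed to state anything about its bimodules. *)
Record bimodule (B : normedModType C) (mul : B -> B -> B)
    (E : normedModType C) := Bimodule {
  lact : B -> E -> E;
  ract : E -> B -> E;
  lact_linearr : forall b, linear (lact b);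
  lact_linearl : forall x, linear (lact^~ x);
  ract_linearl : forall b, linear (ract^~ b);
  ract_linearr : forall x, linear (ract x);
  lact_mul : forall a b x, lact (mul a b) x = lact a (lact b x);
  ract_mul : forall x a b, ract x (mul a b) = ract (ract x a) b;
  lract : forall a x b, ract (lact a x) b = lact a (ract x b);
  lact_bounded : exists k : R, forall b x, `|lact b x| <= k%:C * `|b| * `|x|;
  ract_bounded : exists k : R, forall x b, `|ract x b| <= k%:C * `|x| * `|b| }.

Section Theory.
Variables (B : normedModType C) (mul : B -> B -> B).

Definition contractive E (s : bimodule mul E) :=
  (forall b x, `|lact s b x| <= `|b| * `|x|) /\
  (forall x b, `|ract s x b| <= `|b| * `|x|).

(* The actions are given as functions, so that the definitions apply to
   modules over another algebra acting through a homomorphism. *)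
Definition derivation (E : normedModType C) (l : B -> E -> E)
    (r : E -> B -> E) (D : B -> E) :=
  bounded_linear D /\ forall a b, D (mul a b) = l a (D b) + r (D a) b.

Definition inner (E : normedModType C) (l : B -> E -> E)
    (r : E -> B -> E) (D : B -> E) :=
  exists n : E, forall a, D a = l a n - r n a.

Lemma bl_lact E (s : bimodule mul E) b : bounded_linear (lact s b).
Proof.
have [k lk] := lact_bounded s.
apply: (@bounded_linear_of _ _ _ _ (k * rnorm b)); first exact: lact_linearr.
by move=> x; rewrite rmorphM/= rnormE.
Qed.

Lemma bl_ract E (s : bimodule mul E) b : bounded_linear (ract s ^~ b).
Proof.
have [k rk] := ract_bounded s.
apply: (@bounded_linear_of _ _ _ _ (k * rnorm b)); first exact: ract_linearl.
by move=> x; rewrite rmorphM/= rnormE mulrAC.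
Qed.

Section DualBimodule.
Variables (E : normedModType C) (s : bimodule mul E).

Definition dual_lact (b : B) (phi : dual E) : dual E :=
  adjoint (bl_ract s b) phi.

Definition dual_ract (phi : dual E) (b : B) : dual E :=
  adjoint (bl_lact s b) phi.

Let lrE a : linear (dual_lact a).
Proof. by move=> c f g; apply/val_inj/funext => x. Qed.

Let llE f : linear (dual_lact ^~ f).
Proof.
move=> c a b; apply/val_inj/funext => x /=.
by rewrite ract_linearr; exact: dual_linear.
Qed.

Let rlE b : linear (dual_ract ^~ b).
Proof. by move=> c f g; apply/val_inj/funext => x. Qed.

Let rrE f : linear (dual_ract f).
Proof.
move=> c a b; apply/val_inj/funext => x /=.
by rewrite lact_linearl; exact: dual_linear.
Qed.

Let lM a b f : dual_lact (mul a b) f = dual_lact a (dual_lact b f).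
Proof. by apply/val_inj/funext => x /=; rewrite ract_mul. Qed.

Let rM f a b : dual_ract f (mul a b) = dual_ract (dual_ract f a) b.
Proof. by apply/val_inj/funext => x /=; rewrite lact_mul. Qed.

Let lr a f b : dual_ract (dual_lact a f) b = dual_lact a (dual_ract f b).
Proof. by apply/val_inj/funext => x /=; rewrite lract. Qed.

Let lB : exists k : R, forall b f, `|dual_lact b f| <= k%:C * `|b| * `|f|.
Proof.
have [k rk] := ract_bounded s; exists `|k| => b f.
rewrite !dual_normE -rnormE -!rmorphM lecR; apply: opnorm_le => [|x].
  by rewrite !mulr_ge0// ?opnorm_ge0// -ler0c rnormE.
rewrite !rmorphM/= rnormE (le_trans (le_opnorm _ _))//.
rewrite [_ * (opnorm f)%:C]mulrC -mulrA ler_wpM2l ?ler0c ?opnorm_ge0//.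
rewrite (le_trans (rk _ _))// mulrAC ler_wpM2r// ler_wpM2r//.
by rewrite lecR ler_norm.
Qed.

Let rB : exists k : R, forall f b, `|dual_ract f b| <= k%:C * `|f| * `|b|.
Proof.
have [k rk] := lact_bounded s; exists `|k| => f b.
rewrite !dual_normE -rnormE -!rmorphM lecR; apply: opnorm_le => [|x].
  by rewrite !mulr_ge0// ?opnorm_ge0// -ler0c rnormE.
rewrite !rmorphM/= rnormE (le_trans (le_opnorm _ _))//.
rewrite [_%:C * (opnorm f)%:C]mulrC -!mulrA ler_wpM2l ?ler0c ?opnorm_ge0//.
rewrite (le_trans (rk _ _))// -!mulrA ler_wpM2r ?mulr_ge0//.
by rewrite lecR ler_norm.
Qed.

Definition dual_bimodule : bimodule mul (dual E) :=
  Bimodule lrE llE rlE rrE lM rM lr lB rB.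

End DualBimodule.

Section WAP.
Variables (E : normedModType C) (s : bimodule mul E).

Definition wap_pred : {pred E} := [pred x |
  `[< weakly_compact (lact s ^~ x) /\ weakly_compact (ract s x) >]].

Record WAP := Wap { wap_val :> E; wap_valP : wap_val \in wap_pred }.

HB.instance Definition _ := [isSub for wap_val].
HB.instance Definition _ := [Choice of WAP by <:].

Lemma wap_submod : submod_closed wap_pred.
Proof.
split=> [|c x y /asboolP[lx rx] /asboolP[ly ry]]; apply/asboolP.
  have l0 : lact s ^~ 0 = fun=> 0.
    apply/funext => b; have /(_ (-1) 0 0) := lact_linearr s b.
    by rewrite scaler0 addr0 scaleN1r addNr.
  have r0 : ract s 0 = fun=> 0.
    apply/funext => b; have /(_ (-1) 0 0) := ract_linearl s b.
    by rewrite scaler0 addr0 scaleN1r addNr.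
  by rewrite l0 r0; split; exact: weakly_compact0.
split.
  have -> : lact s ^~ (c *: x + y) = fun b => c *: lact s b x + lact s b y.
    by apply/funext => b; rewrite lact_linearr.
  apply: weakly_compactD => //.
  exact: (weakly_compact_post (bounded_linear_scale E c) lx).
have -> : ract s (c *: x + y) = fun b => c *: ract s x b + ract s y b.
  by apply/funext => b; rewrite ract_linearl.
apply: weakly_compactD => //.
exact: (weakly_compact_post (bounded_linear_scale E c) rx).
Qed.

HB.instance Definition _ := GRing.isSubmodClosed.Build C E wap_pred wap_submod.
HB.instance Definition _ := [SubChoice_isSubLmodule of WAP by <:].

Let norm (x : WAP) : C := `|val x|.

Let normD x y : norm (x + y) <= norm x + norm y.
Proof. exact: ler_normD. Qed.

Let normZ (c : C) x : norm (c *: x) = `|c| * norm x.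
Proof. exact: normrZ. Qed.

Let norm_eq0 x : norm x = 0 -> x = 0.
Proof. by move=> /normr0_eq0 x0; exact: val_inj. Qed.

HB.instance Definition _ := Lmodule_isNormed.Build C WAP normD normZ norm_eq0.

Lemma WAP_normE (x : WAP) : `|x| = `|val x|. Proof. by []. Qed.

End WAP.
End Theory.
End Bimodules.

Section Enveloping.
Variable R : realType.
Local Notation C := R[i].

Definition bidual_embedding (E : normedModType C) (x : E) : dual (dual E).
Proof.
refine (@Dual _ _ (fun phi : dual E => phi x) _); apply/asboolP.
apply: (@bounded_linear_of _ _ _ _ (rnorm x)) => [c f g //|phi].
by rewrite rnormE mulrC dual_normE le_opnorm.
Defined.

Variable A : banachAlgebra R.
Local Notation mul := (@ba_mul R A).

Lemma bl_mulr (a : A) : bounded_linear (mul a).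
Proof.
apply: (@bounded_linear_of _ _ _ _ (rnorm a)); first exact: ba_mul_linearr.
by move=> b; rewrite rnormE ba_norm_mul.
Qed.

Lemma bl_mull (a : A) : bounded_linear (mul^~ a).
Proof.
apply: (@bounded_linear_of _ _ _ _ (rnorm a)); first exact: ba_mul_linearl.
by move=> b; rewrite rnormE mulrC ba_norm_mul.
Qed.

Section WAPBimodule.
Variables (E : normedModType C) (s : bimodule mul E).

Lemma wap_lact_subproof a (x : WAP s) : lact s a (wap_val x) \in wap_pred s.
Proof.
have /asboolP[lx rx] := wap_valP x; apply/asboolP; split.
  have -> : lact s ^~ (lact s a (wap_val x)) =
      (lact s ^~ (wap_val x)) \o (mul^~ a).
    by apply/funext => b /=; rewrite lact_mul.
  apply: weakly_compact_pre lx; last exact: bl_mull.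
  exact: lact_linearl.
have -> : ract s (lact s a (wap_val x)) = lact s a \o ract s (wap_val x).
  by apply/funext => b /=; rewrite lract.
by apply: weakly_compact_post rx; exact: bl_lact.
Qed.

Lemma wap_ract_subproof (x : WAP s) a : ract s (wap_val x) a \in wap_pred s.
Proof.
have /asboolP[lx rx] := wap_valP x; apply/asboolP; split.
  have -> : lact s ^~ (ract s (wap_val x) a) =
      (ract s ^~ a) \o (lact s ^~ (wap_val x)).
    by apply/funext => b /=; rewrite lract.
  by apply: weakly_compact_post lx; exact: bl_ract.
have -> : ract s (ract s (wap_val x) a) = ract s (wap_val x) \o mul a.
  by apply/funext => b /=; rewrite ract_mul.
apply: weakly_compact_pre rx; last exact: bl_mulr.
exact: ract_linearr.
Qed.

Definition wap_lact a (x : WAP s) : WAP s := Wap (wap_lact_subproof a x).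
Definition wap_ract (x : WAP s) a : WAP s := Wap (wap_ract_subproof x a).

Let lrE a : linear (wap_lact a).
Proof. by move=> c x y; apply/val_inj; rewrite /= lact_linearr. Qed.

Let llE x : linear (wap_lact ^~ x).
Proof. by move=> c a b; apply/val_inj; rewrite /= lact_linearl. Qed.

Let rlE a : linear (wap_ract ^~ a).
Proof. by move=> c x y; apply/val_inj; rewrite /= ract_linearl. Qed.

Let rrE x : linear (wap_ract x).
Proof. by move=> c a b; apply/val_inj; rewrite /= ract_linearr. Qed.

Let lM a b x : wap_lact (mul a b) x = wap_lact a (wap_lact b x).
Proof. by apply/val_inj; rewrite /= lact_mul. Qed.

Let rM x a b : wap_ract x (mul a b) = wap_ract (wap_ract x a) b.
Proof. by apply/val_inj; rewrite /= ract_mul. Qed.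

Let lr a x b : wap_ract (wap_lact a x) b = wap_lact a (wap_ract x b).
Proof. by apply/val_inj; rewrite /= lract. Qed.

Let lB : exists k : R, forall b x, `|wap_lact b x| <= k%:C * `|b| * `|x|.
Proof. by have [k lk] := lact_bounded s; exists k => b x; exact: lk. Qed.

Let rB : exists k : R, forall x b, `|wap_ract x b| <= k%:C * `|x| * `|b|.
Proof. by have [k rk] := ract_bounded s; exists k => x b; exact: rk. Qed.

Definition wap_bimodule : bimodule mul (WAP s) :=
  Bimodule lrE llE rlE rrE lM rM lr lB rB.

Lemma bl_wap_val : bounded_linear (@wap_val _ _ _ _ s).
Proof.
by apply: (@bounded_linear_of _ _ _ _ 1) => // x; rewrite mul1r.
Qed.

End WAPBimodule.

Section EnvelopingModule.
Variables (X : normedModType C) (s : bimodule mul X).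

(* The bimodules F_A(X)_* = WAP_A(X^* ) and F_A(X) = (F_A(X)_* )^*. *)
Definition enveloping_predual : normedModType C := WAP (dual_bimodule s).
Definition enveloping : normedModType C := dual enveloping_predual.

Definition enveloping_bimodule : bimodule mul enveloping :=
  dual_bimodule (wap_bimodule (dual_bimodule s)).

(* Restriction of functionals from X^* to WAP_A(X^* ). *)
Definition enveloping_quotient : dual (dual X) -> enveloping :=
  adjoint (bl_wap_val (dual_bimodule s)).

Definition eta (x : X) : enveloping :=
  enveloping_quotient (bidual_embedding x).

End EnvelopingModule.

Lemma regular_bounded :
  exists k : R, forall a b : A, `|mul a b| <= k%:C * `|a| * `|b|.
Proof. by exists 1 => a b; rewrite mul1r ba_norm_mul. Qed.

Definition regular : bimodule mul A :=
  Bimodule (@ba_mul_linearr R A) (@ba_mul_linearl R A) (@ba_mul_linearl R A)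
    (@ba_mul_linearr R A) (fun a b x => esym (ba_mulA a b x))
    (fun x a b => ba_mulA x a b) (fun a x b => esym (ba_mulA a x b))
    regular_bounded regular_bounded.

(* First Arens product:
   (Phi # Psi)(phi) = Phi (Psi . phi), (Psi . phi)(a) = Psi (phi . a). *)
Definition arens_act (Psi : dual (dual A)) (phi : dual A) : dual A.
Proof.
refine (@Dual _ _ (fun a => Psi (ract (dual_bimodule regular) phi a)) _).
apply/asboolP; apply: (@bounded_linear_comp _ _ _ _ Psi).
  exact/asboolP/dual_funP.
have [k rk] := ract_bounded (dual_bimodule regular).
apply: (@bounded_linear_of _ _ _ _ (k * rnorm phi)).
  exact: (ract_linearr (dual_bimodule regular) phi).
by move=> a; rewrite rmorphM/= rnormE; exact: rk.
Defined.

Definition arens (Phi Psi : dual (dual A)) : dual (dual A).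
Proof.
refine (@Dual _ _ (fun phi => Phi (arens_act Psi phi)) _).
apply/asboolP; apply: (@bounded_linear_comp _ _ _ _ Phi).
  exact/asboolP/dual_funP.
have [k k0 rk] : exists2 k : R, 0 <= k & forall phi a,
    `|ract (dual_bimodule regular) phi a| <= k%:C * `|phi| * `|a|.
  have [k rk] := ract_bounded (dual_bimodule regular).
  exists `|k| => // phi a; rewrite (le_trans (rk _ _))// -!mulrA.
  by rewrite ler_wpM2r ?mulr_ge0// lecR ler_norm.
apply: (@bounded_linear_of _ _ _ _ (opnorm Psi * k)).
  move=> c f g; apply/val_inj/funext => a.
  have fgE := ract_linearl (dual_bimodule regular) a c f g.
  rewrite -[LHS]/(Psi (ract (dual_bimodule regular) (c *: f + g) a)) fgE.
  exact: dual_linear.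
move=> phi; rewrite -(rnormE phi) -rmorphM dual_normE lecR.
apply: opnorm_le => [|a].
  by rewrite !mulr_ge0 ?opnorm_ge0// -ler0c rnormE.
rewrite (le_trans (le_opnorm Psi _))// !rmorphM/= rnormE -!mulrA.
by rewrite ler_wpM2l ?ler0c ?opnorm_ge0// mulrA; exact: rk.
Defined.

Definition enveloping_algebra : normedModType C := enveloping regular.

(* The unique product making the quotient map from the bidual, with the first
   Arens product, a homomorphism. *)
Definition enveloping_mul :
    enveloping_algebra -> enveloping_algebra -> enveloping_algebra :=
  xget (fun _ _ => 0) [set m | forall Phi Psi : dual (dual A),
    enveloping_quotient regular (arens Phi Psi) =
    m (enveloping_quotient regular Phi) (enveloping_quotient regular Psi)].

Definition eta_algebra : A -> enveloping_algebra := eta regular.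

End Enveloping.

Section Connes.
Variable R : realType.
Local Notation C := R[i].

(* The image in E^** of E, which induces on E^* its weak* topology. *)
Definition canonical_predual (E : normedModType C) : set (dual (dual E)) :=
  range (@bidual_embedding R E).
Arguments canonical_predual : clear implicits.

Definition enveloping_algebra_predual (A : banachAlgebra R) :
    set (dual (enveloping_algebra A)) :=
  canonical_predual (enveloping_predual (regular A)).

Definition sigma_continuous (E G : normedModType C) (P : set (dual E))
    (Q : set (dual G)) (f : E -> G) :=
  continuous (f : sigma_topology P -> sigma_topology Q).

Section Normal.
Variables (B : normedModType C) (mul : B -> B -> B) (Bpre : set (dual B)).

(* The dual bimodule of s is normal, for the weak* topology given on B by the
   predual Bpre. *)
Definition normal_dual (N : normedModType C) (s : bimodule mul N) :=
  forall x : dual N,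
    sigma_continuous Bpre (canonical_predual N)
      (fun b => lact (dual_bimodule s) b x) /\
    sigma_continuous Bpre (canonical_predual N)
      (fun b => ract (dual_bimodule s) x b).

(* Connes-amenability of the dual Banach algebra (B, mul) with predual Bpre. *)
Definition Connes_amenable :=
  forall (N : completeNormedModType C) (s : bimodule mul N), normal_dual s ->
  forall D : B -> dual N,
    derivation mul (lact (dual_bimodule s)) (ract (dual_bimodule s)) D ->
    sigma_continuous Bpre (canonical_predual N) D ->
    inner (lact (dual_bimodule s)) (ract (dual_bimodule s)) D.

End Normal.

End Connes.

Arguments canonical_predual {R} E _.
Arguments enveloping_algebra_predual {R} A _.
Arguments enveloping_mul {R} A _ _.
Arguments ba_mul {R} _ _ _.

(* Main.v *)
From HB Require Import structures.
From mathcomp Require Import all_boot all_order all_algebra.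
From mathcomp Require Import all_classical all_reals all_analysis.
From mathcomp Require Import complex.
From mathcomp Require Import ring lra.
Require Import Defs.
Set Implicit Arguments.
Unset Strict Implicit.
Unset Printing Implicit Defensive.
Import Order.TTheory GRing.Theory Num.Theory.
Import numFieldNormedType.Exports.
Local Open Scope classical_set_scope.
Local Open Scope ring_scope.
Local Open Scope complex_scope.

(** For a bimodule X over A, a functional f on X and Phi in the bidual of A,
    the Arens actions are the functionals
      (Phi . f)(x) = Phi (a |-> f (x . a)),  (f . Phi)(x) = Phi (a |-> f (a . x)).
    Everything rests on a criterion for weak compactness of a bounded map T
    into a dual space: the two iterated extensions of the bilinear form
    (a, x) |-> T a x to the biduals agree ([weakly_compactP]).  One direction
    uses Goldstine's theorem, the other the theorem of Banach and Alaoglu.  For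
    WAP (X^* ) it says that f is weakly almost periodic iff, for all Phi and all
    y in the bidual of X^*, evaluating y at the Arens actions of Phi on f amounts
    to applying Phi to the orbit functions a |-> y (a . f), a |-> y (f . a)
    ([wapP]).  From then on weak compactness is an algebraic identity.

    Both sides of this identity are bounded in f, so WAP (X^* ) is an
    intersection of kernels of elements of X^*** ([wap_bipolar]).  Hence it is
    closed, and it contains every functional Phi (a |-> T a x), in x, for T
    weakly compact with values in it ([wap_average]).  This yields that the
    coefficient functions a |-> f (a . x), a |-> y (f . a), and their mirror
    images, lie in WAP (A^* ), and that the Arens actions preserve WAP (X^* ).
    For X = A, with the theorem of Hahn and Banach lifting functionals on
    WAP (A^* ) to the bidual of A, the Arens product descends to F(A); in
    general F(A) acts on WAP (X^* ), and F_A(X) is a normal dual F(A)-bimodule,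
    contractive when X is.  Applied to eta D this gives (iii) => (ii)
    ([derivations_to_envelope]).

    For (i) => (iii), let N^* be a normal dual F(A)-bimodule.  A weak*-continuous
    functional on F(A) comes from WAP (A^* ), so Psi (a |-> f (eta a . x)) =
    f (Psi . x) for f in N^*, x in N and Psi in the bidual of A
    ([normal_lcoef], [normal_rcoef]).  For a derivation D from A to N^*, the
    product rule therefore computes both iterated extensions of
    (a, b) |-> D (ab)(x), and they agree.  So a |-> D a x lies in WAP (A^* ), the
    map Phi |-> (x |-> Phi (a |-> D a x)) is a weak*-continuous extension of D to
    F(A), and the same computation shows that it is a derivation
    ([extend_derivationP]).

    For (ii) => (i), restrict a weak*-continuous derivation F(A) -> N^* to A
    along eta, and renorm N^* so that it becomes a contractive A-bimodule M.
    Normality makes evaluation at each point of N weakly almost periodic on M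
    ([renormed_eval_wap]), which gives a bimodule projection of F_A(M) onto N^*
    carrying eta_M D to D; so D is inner on eta(A), hence on F(A), because a
    weak*-continuous functional on F(A) that vanishes on eta(A) is zero. *)

(** * Real-valued norms and bounded linear maps *)

Section RealNorm.
Variable R : realType.
Local Notation C := R[i].
Implicit Types E G : normedModType C.

Lemma rnorm_ge0 E (x : E) : 0 <= rnorm x.
Proof. by rewrite -ler0c rnormE. Qed.

Lemma rnorm0 E : rnorm (0 : E) = 0.
Proof. by rewrite /rnorm normr0. Qed.

Lemma rnormN E (x : E) : rnorm (- x) = rnorm x.
Proof. by rewrite /rnorm normrN. Qed.

Lemma rnormD E (x y : E) : rnorm (x + y) <= rnorm x + rnorm y.
Proof. by rewrite -lecR rmorphD/= !rnormE ler_normD. Qed.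

Lemma rnormZ E (a : C) (x : E) : rnorm (a *: x) = rnorm (a : C^o) * rnorm x.
Proof. by apply: complexI; rewrite rmorphM/= !rnormE normrZ. Qed.

Lemma rnormZr E (r : R) (x : E) : rnorm (r%:C *: x) = `|r| * rnorm x.
Proof.
rewrite rnormZ; congr (_ * _); apply: complexI.
by rewrite rnormE normc_def/= expr0n/= addr0 sqrtr_sqr.
Qed.

Lemma rnorm_eq0 E (x : E) : rnorm x = 0 -> x = 0.
Proof. by move=> x0; apply: normr0_eq0; rewrite -rnormE x0. Qed.

Lemma ler_rnorm E G (x : E) (y : G) (k : R) :
  (`|x| <= k%:C * `|y|) = (rnorm x <= k * rnorm y).
Proof. by rewrite -!rnormE -rmorphM lecR. Qed.

Lemma rnorm_le1 E (x : E) : (`|x| <= 1) = (rnorm x <= 1).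
Proof. by rewrite -rnormE -lecR. Qed.

Lemma Re_le_rnorm (z : C) : complex.Re z <= rnorm (z : C^o).
Proof.
rewrite -lecR rnormE; apply: le_trans (normc_ge_Re z).
by rewrite lecR ler_norm.
Qed.

Lemma normRe_le_rnorm (z : C) : `|complex.Re z| <= rnorm (z : C^o).
Proof. by rewrite -lecR rnormE normc_ge_Re. Qed.

Lemma rnormM (a b : C) : rnorm (a * b : C^o) = rnorm (a : C^o) * rnorm (b : C^o).
Proof. exact: (@rnormZ C^o a b). Qed.

Lemma rnorm_i : rnorm ('i : C^o) = 1 :> R.
Proof.
by apply: complexI; rewrite rnormE normc_def/= expr0n/= add0r expr1n sqrtr1.
Qed.

Lemma rnorm_real (r : R) : rnorm (r%:C : C^o) = `|r|.
Proof.
apply: complexI; rewrite rnormE normc_def/= expr0n/= addr0.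
by rewrite sqrtr_sqr.
Qed.

Lemma normIm_le_rnorm (z : C) : `|complex.Im z| <= rnorm (z : C^o).
Proof.
have := normRe_le_rnorm (z * 'i); rewrite ReiNIm normrN.
by rewrite rnormM rnorm_i mulr1.
Qed.

Lemma rnorm_le_ReIm (z : C) :
  rnorm (z : C^o) <= `|complex.Re z| + `|complex.Im z|.
Proof.
rewrite {1}(complexE z); apply: le_trans (rnormD _ _) _.
by rewrite rnormM rnorm_i mul1r !rnorm_real.
Qed.

Lemma linear0_of E G (T : E -> G) : linear T -> T 0 = 0.
Proof.
by move=> /(_ (-1) 0 0); rewrite scaler0 addr0 scaleN1r addNr.
Qed.

Lemma linearZ_of E G (T : E -> G) : linear T -> forall a x, T (a *: x) = a *: T x.
Proof. by move=> lT a x; have := lT a x 0; rewrite (linear0_of lT) !addr0. Qed.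

Lemma linearD_of E G (T : E -> G) : linear T -> forall x y, T (x + y) = T x + T y.
Proof. by move=> lT x y; have := lT 1 x y; rewrite !scale1r. Qed.

Lemma linearN_of E G (T : E -> G) : linear T -> forall x, T (- x) = - T x.
Proof. by move=> lT x; rewrite -scaleN1r (linearZ_of lT) scaleN1r. Qed.

Lemma linearB_of E G (T : E -> G) : linear T -> forall x y, T (x - y) = T x - T y.
Proof. by move=> lT x y; rewrite (linearD_of lT) (linearN_of lT). Qed.

Lemma bounded_linear_rnorm E G (T : E -> G) (k : R) :
  linear T -> (forall x, rnorm (T x) <= k * rnorm x) -> bounded_linear T.
Proof.
by move=> lT Tk; apply: (bounded_linear_of lT) => x; rewrite ler_rnorm.
Qed.

Lemma bounded_linear_bound E G (T : E -> G) : bounded_linear T ->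
  linear T /\ exists2 k : R, 0 <= k & forall x, rnorm (T x) <= k * rnorm x.
Proof.
move=> /bounded_linearP[lT [k k0 Tk]]; split=> //; exists k; first exact: ltW.
by move=> x; rewrite -ler_rnorm.
Qed.

Lemma dual_apply_le E (f : dual E) x : rnorm (f x) <= rnorm f * rnorm x.
Proof. by rewrite -ler_rnorm; exact: le_opnorm. Qed.

Lemma rnorm_dual_le E (f : dual E) (k : R) : 0 <= k ->
  (forall x, rnorm (f x) <= k * rnorm x) -> rnorm f <= k.
Proof.
by move=> k0 fk; apply: opnorm_le => // x; rewrite ler_rnorm.
Qed.

Lemma dual0 E (f : dual E) : f 0 = 0.
Proof. exact/linear0_of/dual_linear. Qed.
Lemma dualD E (f : dual E) x y : f (x + y) = f x + f y.
Proof. exact/linearD_of/dual_linear. Qed.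
Lemma dualB E (f : dual E) x y : f (x - y) = f x - f y.
Proof. exact/linearB_of/dual_linear. Qed.
Lemma dualN E (f : dual E) x : f (- x) = - f x.
Proof. exact/linearN_of/dual_linear. Qed.
Lemma dualZ E (f : dual E) (a : C) x : f (a *: x) = a * f x.
Proof. exact: (linearZ_of (dual_linear f)). Qed.

Lemma dual_ext E (f g : dual E) : (forall x, f x = g x) -> f = g.
Proof. by move=> fg; apply/val_inj/funext. Qed.

Definition mkdual E (f : E -> C^o) (bf : bounded_linear f) : dual E.
Proof. by exists f; exact/asboolP. Defined.

Lemma cvg_rnormP E (F : set_system E) (x : E) : Filter F ->
  (F --> x) <-> (forall e : R, 0 < e -> \forall y \near F, rnorm (x - y) < e).
Proof.
move=> FF; split=> [Fx e e0|H].
  have : \forall y \near F, `|x - y| < e%:C.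
    by apply: (@cvgr_dist_lt _ _ _ F _ id x Fx); rewrite ltcR.
  by apply: filterS => y; rewrite -rnormE ltcR.
apply/cvgrPdist_lt => e e0.
have eR : (complex.Re e)%:C = e by apply: RRe_real; exact: gtr0_real.
have : 0 < complex.Re e by rewrite -ltcR eR.
by move=> /H; apply: filterS => y; rewrite -eR -rnormE ltcR.
Qed.

Lemma cvg_fmap_rnormP T E (F : set_system T) (f : T -> E) (x : E) : Filter F ->
  (f @ F --> x) <-> (forall e : R, 0 < e -> \forall t \near F, rnorm (x - f t) < e).
Proof. by move=> FF; split=> [/cvg_rnormP|H]; [|apply/cvg_rnormP]. Qed.

End RealNorm.

(** * Convergence in the complex plane *)

Section ComplexTopology.
Variable R : realType.
Local Notation C := R[i].
Implicit Types E G : normedModType C.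

Lemma cauchy_rnormP E (F : set_system E) : ProperFilter F ->
  cauchy F <-> (forall e : R, 0 < e -> exists x, \forall y \near F, rnorm (x - y) < e).
Proof.
move=> PF; split=> [/cauchyP cF e e0|H].
  have [|x Fx] := cF e%:C; first by rewrite ltcR.
  exists x; apply: filterS Fx => y; rewrite -ball_normE/=.
  by rewrite -rnormE ltcR.
apply: cauchy_exP => e e0.
have eR : (complex.Re e)%:C = e by apply: RRe_real; exact: gtr0_real.
have : 0 < complex.Re e by rewrite -ltcR eR.
move=> /H[x Fx]; exists x; apply: filterS Fx => y; rewrite -ball_normE/=.
by rewrite -eR -rnormE ltcR.
Qed.

Lemma cvg_ReIm (F : set_system C^o) (a b : R) : Filter F ->
  @complex.Re R @ F --> a -> @complex.Im R @ F --> b -> F --> (a +i* b : C^o).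
Proof.
move=> FF /cvgrPdist_lt Fa /cvgrPdist_lt Fb; apply/cvg_rnormP => e e0.
have e2 : 0 < e / 2 by rewrite divr_gt0.
move: (Fa _ e2) (Fb _ e2); rewrite !near_simpl => {}Fa {}Fb.
near=> z.
have := @rnorm_le_ReIm R (a +i* b - z).
have za : `|a - complex.Re z| < e / 2 by near: z.
have zb : `|b - complex.Im z| < e / 2 by near: z.
rewrite raddfB [X in _ + `|X|]raddfB /= => /le_lt_trans; apply.
by rewrite [ltRHS](splitr e) ltrD.
Unshelve. all: by end_near. Qed.

Lemma fmap_ultra (T U : Type) (f : T -> U) (F : set_system T) :
  UltraFilter F -> UltraFilter (f @ F).
Proof.
move=> UF; split=> [|G PG sFG]; first exact: fmap_proper_filter.
apply/seteqP; split=> // A GA.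
have [//|FnA] := in_ultra_setVsetC (f @^-1` A) UF.
have GnA : G (~` A) by apply: sFG.
by have [y []] := filter_ex (filterI GA GnA).
Qed.

(** Compactness of discs, reduced to that of segments through the real and
    imaginary parts. *)
Lemma cvg_complex_ultra (F : set_system C^o) (k : R) : UltraFilter F ->
  F [set z : C^o | rnorm z <= k] -> exists z : C^o, F --> z.
Proof.
move=> UF Fk.
have cvg_part (f : C -> R) : (forall z, `|f z| <= rnorm (z : C^o)) ->
    exists a : R, f @ F --> a.
  move=> fk; have := @segment_compact R (- k) k; rewrite compact_ultra => /= /(_ (f @ F)).
  have Uf : UltraFilter (f @ F) by exact: fmap_ultra.
  have Ff : F (f @^-1` `[- k, k]%classic).
    apply: filterS Fk => z /= zk; rewrite in_itv/= -ler_norml.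
    exact: le_trans (fk z) zk.
  by move=> /(_ Uf Ff)[a [_ Fa]]; exists a.
have [a Fa] := cvg_part _ (@normRe_le_rnorm R).
have [b Fb] := cvg_part _ (@normIm_le_rnorm R).
by exists (a +i* b); exact: cvg_ReIm.
Qed.

Lemma cvg_complex_cauchy (F : set_system C^o) : ProperFilter F ->
  cauchy F -> exists z : C^o, F --> z.
Proof.
move=> PF /cauchy_rnormP cF.
have cvg_part (f : C -> R) : (forall z w, `|f z - f w| <= rnorm (z - w : C^o)) ->
    exists a : R, f @ F --> a.
  move=> fk; apply/cvg_ex; apply: (@cauchy_cvg R^o).
  apply: cauchy_exP => e e0; have [z Fz] := cF _ e0.
  exists (f z); apply: filterS Fz => w zw; rewrite -ball_normE/=.
  exact: le_lt_trans (fk z w) zw.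
have [|a Fa] := cvg_part (@complex.Re R).
  by move=> z w; rewrite -raddfB; exact: normRe_le_rnorm.
have [|b Fb] := cvg_part (@complex.Im R).
  by move=> z w; rewrite -raddfB; exact: normIm_le_rnorm.
by exists (a +i* b); exact: cvg_ReIm.
Qed.

End ComplexTopology.

(** * Completeness and weak* compactness of dual spaces *)

Section DualSpace.
Variable R : realType.
Local Notation C := R[i].
Implicit Types E G : normedModType C.

(** Shared by completeness of the dual, where the filter is Cauchy, and by the
    Banach-Alaoglu theorem, where it is an ultrafilter on a ball. *)
Lemma pointwise_limit E (F : set_system (dual E)) (l : E -> C^o) (k : R) :
  ProperFilter F -> (forall x, (fun f : dual E => f x : C^o) @ F --> l x) ->
  F [set f | rnorm f <= k] -> exists2 g : dual E, rnorm g <= k & forall x, g x = l x.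
Proof.
move=> PF Fl Fk.
have k0 : 0 <= k by have [f /= fk] := filter_ex Fk; exact: le_trans (rnorm_ge0 f) fk.
have lk x : rnorm (l x) <= k * rnorm x.
  apply/ler_addgt0Pr => e e0.
  have /cvg_fmap_rnormP/(_ e e0) Fx := Fl x.
  have [f /= [fe fk]] := filter_ex (filterI Fx Fk).
  rewrite -(subrK (f x) (l x)) addrC; apply: le_trans (rnormD _ _) _.
  apply: lerD; last exact: ltW.
  by apply: le_trans (dual_apply_le f x) _; rewrite ler_wpM2r// rnorm_ge0.
have ll : linear l.
  move=> a x y; apply: (@cvg_unique C^o _ ((fun f : dual E => f (a *: x + y) : C^o) @ F)).
  - exact: norm_hausdorff.
  - exact: Fl.
  - have -> : (fun f : dual E => f (a *: x + y) : C^o) =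
      (fun f : dual E => a *: (f x : C^o) + (f y : C^o)).
      by apply/funext => f; rewrite dualD dualZ.
    by apply: cvgD; [apply: cvgZr; exact: Fl|exact: Fl].
have bl := bounded_linear_rnorm ll lk.
by exists (mkdual bl) => //; exact: rnorm_dual_le.
Qed.

(** The pointwise limit is a limit in norm, because the Cauchy estimate is
    uniform on the unit ball. *)
Lemma dual_complete E (F : set_system (dual E)) : ProperFilter F ->
  cauchy F -> cvg F.
Proof.
move=> PF /cauchy_rnormP cF.
have /choice[l Fl] : forall x, exists z : C^o, (fun f : dual E => f x : C^o) @ F --> z.
  move=> x; apply: cvg_complex_cauchy; apply/cauchy_rnormP => e e0.
  have x0 : 0 < rnorm x + 1 by rewrite ltr_wpDl// rnorm_ge0.
  have [f Ff] := cF _ (divr_gt0 e0 x0).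
  exists (f x); rewrite near_simpl; apply: filterS Ff => g fg.
  rewrite -[_ - _]/((f - g) x) (le_lt_trans (dual_apply_le _ _))//.
  move: fg; rewrite ltr_pdivlMr//; apply: le_lt_trans.
  by rewrite ler_wpM2l ?rnorm_ge0// lerDl.
(* Cauchyness at scale 1 already confines the filter to a ball. *)
have [f1 Ff1] := cF 1 ltr01.
have [|g _ gl] := pointwise_limit PF Fl (k := rnorm f1 + 1).
  apply: filterS Ff1 => f /= f1f; rewrite -(subrK f1 f) addrC.
  rewrite (le_trans (rnormD _ _))// lerD2l -rnormN opprB; exact: ltW.
apply/cvg_ex; exists g; apply/cvg_rnormP => e e0.
have e4 : 0 < e / 4 by rewrite divr_gt0.
have [f0 Ff0] := cF _ e4; apply: (filterS _ (Ff0)) => f f0f.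
apply: (@le_lt_trans _ _ (e / 2)); last by rewrite ltr_pdivrMr// ltr_pMr// ltr1n.
apply: rnorm_dual_le => [|x]; first by rewrite divr_ge0// ltW.
apply/ler_addgt0Pr => d d0.
have /cvg_fmap_rnormP/(_ d d0) Fx := Fl x.
have [h /= [hd f0h]] := filter_ex (filterI Fx Ff0).
rewrite -[X in rnorm X]/(g x - f x) gl.
have -> : l x - f x = (l x - h x) + ((f0 - f) x - (f0 - h) x).
  by rewrite -[(f0 - f) x]/(f0 x - f x) -[(f0 - h) x]/(f0 x - h x); ring.
have small (h' : dual E) : rnorm (f0 - h') < e / 4 ->
    rnorm ((f0 - h') x) <= e / 4 * rnorm x.
  move=> f0h'; apply: le_trans (dual_apply_le _ _) _.
  by rewrite ler_wpM2r ?rnorm_ge0// ltW.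
have -> : e / 2 * rnorm x + d = d + (e / 4 * rnorm x + e / 4 * rnorm x) by field.
apply: le_trans (rnormD _ _) _; apply: lerD (ltW hd) _.
apply: le_trans (rnormD _ _) _; rewrite rnormN.
exact: lerD (small _ f0f) (small _ f0h).
Qed.

HB.instance Definition _ E :=
  Uniform_isComplete.Build (dual E) (@dual_complete E).

Lemma cvg_to_sigma E (P : set (dual E)) (F : set_system E) (x : E) :
  Filter F -> (forall phi, P phi -> (phi : E -> C^o) @ F --> (phi x : C^o)) ->
  (F : set_system (sigma_topology P)) --> (x : sigma_topology P).
Proof.
move=> FF FP A /=; rewrite nbhs_simpl; move=> [_ [[U oU <-] /= Ux UA]].
set ev := (fun (x : E) => (fun phi : {phi | phi \in P} => sval phi x) :
  {ptws {phi | phi \in P} -> C^o}) in Ux UA.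
suff Fev : ev @ F --> ev x.
  have : nbhs (ev x) U by exact: open_nbhs_nbhs.
  by move=> /Fev; rewrite nbhs_simpl; apply: (@filterS _ F) => y; exact: UA.
apply/cvg_sup => -[phi Pphi] B /=; rewrite nbhs_simpl.
move=> [_ [[V oV <-] /= Vx VB]].
have : \forall y \near F, V (phi y).
  by apply: (FP phi (set_mem Pphi)); exact: open_nbhs_nbhs.
by apply: (@filterS _ F) => y; exact: VB.
Qed.

(** An ultrafilter on the ball has bounded, hence convergent, evaluations at
    every point; their limits form a functional in the same ball. *)
Lemma banach_alaoglu E (k : R) :
  compact ([set f | rnorm f <= k] : set (sigma_topology (@canonical_predual R E))).
Proof.
rewrite compact_ultra => F UF Fk.
have /choice[l Fl] : forall x, exists z : C^o, (fun f : dual E => f x : C^o) @ F --> z.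
  move=> x; have UFx : UltraFilter ((fun f : dual E => f x : C^o) @ F) by exact: fmap_ultra.
  have Fx : F [set f : dual E | rnorm (f x : C^o) <= k * rnorm x].
    apply: (@filterS _ F) Fk => f /= fk.
    by apply: le_trans (dual_apply_le f x) _; rewrite ler_wpM2r// rnorm_ge0.
  exact: (@cvg_complex_ultra _ _ (k * rnorm x)).
have [g gk gl] := pointwise_limit _ Fl Fk.
exists g; split=> //; apply: cvg_to_sigma => _ [x _ <-] /=.
by rewrite gl; exact: Fl.
Qed.


End DualSpace.

(** * The theorem of Hahn and Banach *)

Section HahnBanach.
Variable R : realType.
Local Notation C := R[i].

Section Sublinear.
Variable E : normedModType C.

Definition sublinear (q : E -> R) :=
  (forall x y, q (x + y) <= q x + q y) /\
  (forall (r : R) x, 0 < r -> q (r%:C *: x) <= r * q x).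

Lemma sublinearZ q (r : R) x : sublinear q -> 0 < r -> q (r%:C *: x) = r * q x.
Proof.
move=> [_ qZ] r0; apply/eqP; rewrite eq_le qZ//=.
have rV : r%:C \is a GRing.unit by rewrite unitfE gt_eqF// ltcR.
have /(_ (r%:C *: x)) := qZ r^-1 _ _; rewrite invr_gt0 => /(_ r0).
rewrite fmorphV scalerA mulVr// scale1r.
by rewrite ler_pdivlMl.
Qed.

Lemma sublinear0 q : sublinear q -> q 0 = 0.
Proof.
move=> sq; have := sublinearZ 0 sq (ltr0Sn _ 1).
rewrite scaler0 => q2; lra.
Qed.

Lemma sublinear_geN q x : sublinear q -> - q (- x) <= q x.
Proof.
move=> sq; have := sq.1 x (- x); rewrite subrr sublinear0// => H; lra.
Qed.

(** For a family of functions that need not be sublinear one by one, but is so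
    jointly: the infimum arises in three ways below, as the lower bound of a
    chain, as the function forcing additivity, and as the sublinear function that
    encodes the functional to be extended. *)
Definition pointwise_inf I (Q : I -> E -> R) (x : E) : R :=
  inf [set Q i x | i in setT].

Section PointwiseInf.
Variables (I : Type) (i0 : I) (Q : I -> E -> R) (b : E -> R).
Hypothesis Qb : forall i x, b x <= Q i x.

Lemma pointwise_inf_le i x : pointwise_inf Q x <= Q i x.
Proof.
apply: ge_inf; last by exists i.
by exists (b x) => _ [j _ <-].
Qed.

Lemma le_pointwise_inf (c : R) x : (forall i, c <= Q i x) -> c <= pointwise_inf Q x.
Proof.
move=> cQ; apply: lb_le_inf; first by exists (Q i0 x); exists i0.
by move=> _ [i _ <-].
Qed.

Lemma sublinear_pointwise_inf :
  (forall i j x y, exists k, Q k (x + y) <= Q i x + Q j y) ->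
  (forall i (r : R) x, 0 < r -> exists k, Q k (r%:C *: x) <= r * Q i x) ->
  sublinear (pointwise_inf Q).
Proof.
move=> QD QZ; split=> [x y|r x r0].
  rewrite -lerBlDr; apply: le_pointwise_inf => i.
  rewrite lerBlDr -lerBlDl; apply: le_pointwise_inf => j.
  rewrite lerBlDl; have [k kij] := QD i j x y.
  exact: le_trans (pointwise_inf_le k _) kij.
rewrite -ler_pdivrMl//; apply: le_pointwise_inf => i; rewrite ler_pdivrMl//.
by have [k ki] := QZ i r x r0; exact: le_trans (pointwise_inf_le k _) ki.
Qed.

End PointwiseInf.

(** Zorn's lemma; along a chain the pointwise infimum stays finite because
    - p (- x) is a common lower bound. *)
Lemma sublinear_minimal p : sublinear p ->
  exists2 q, sublinear q & (forall x, q x <= p x) /\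
    forall q', sublinear q' -> (forall x, q' x <= q x) -> q' = q.
Proof.
move=> sp; pose T := {q | sublinear q /\ forall x, q x <= p x}.
pose le_T (s t : T) := `[< forall x, sval t x <= sval s x >].
have [t tmax] : exists t, forall s, le_T t s -> s = t.
  apply: Zorn => [t|r s t|s t|A totA].
  - exact/asboolP.
  - move=> /asboolP rs /asboolP st; apply/asboolP => x.
    exact: le_trans (st x) (rs x).
  - case: s t => s ps [t pt] /asboolP/= st /asboolP/= ts.
    have s_t : s = t by apply/funext => x; apply/eqP; rewrite eq_le st ts.
    by move: ps pt; rewrite s_t => ps pt; congr exist; exact: Prop_irrelevance.
  have [[t0 At0]|A0] := pselect (exists t, A t); last first.
    exists (exist _ p (conj sp (fun=> lexx _))) => s As.
    by case: A0; exists s.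
  pose I := {t | A t}; pose Q (i : I) := sval (sval i).
  have Qb i x : - p (- x) <= Q i x.
    have [sq qp] := svalP (sval i).
    by apply: le_trans (sublinear_geN x sq); rewrite lerN2 qp.
  pose i0 : I := exist _ t0 At0.
  have sm : sublinear (pointwise_inf Q).
    apply: (@sublinear_pointwise_inf _ i0 _ _ Qb) => [i j x y|i r x r0]; last first.
      by exists i; exact: (svalP (sval i)).1.2.
    have [/asboolP ij|/asboolP ji] := totA _ _ (svalP i) (svalP j).
      exists j; apply: le_trans ((svalP (sval j)).1.1 x y) _.
      by rewrite lerD2r; exact: ij.
    exists i; apply: le_trans ((svalP (sval i)).1.1 x y) _.
    by rewrite lerD2l; exact: ji.
  have mp x : pointwise_inf Q x <= p x.
    exact: le_trans (pointwise_inf_le Qb i0 x) ((svalP t0).2 x).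
  exists (exist _ (pointwise_inf Q) (conj sm mp)) => s As; apply/asboolP => x /=.
  exact: (pointwise_inf_le Qb (exist _ s As : I)).
exists (sval t); first exact: (svalP t).1.
split=> [|q sq qt]; first exact: (svalP t).2.
have qp x : q x <= p x := le_trans (qt x) ((svalP t).2 x).
by have /(congr1 sval) := tmax (exist _ q (conj sq qp)) (asboolT qt).
Qed.

(** A minimal sublinear function is additive, which proves the Hahn-Banach
    theorem without extending partially defined functionals. *)
Lemma sublinear_additive_below p : sublinear p ->
  exists2 q, sublinear q & (forall x, q x <= p x) /\
    forall x y, q (x + y) = q x + q y.
Proof.
move=> /sublinear_minimal[q sq [qp qmin]]; exists q => //; split=> // x y.
apply/eqP; rewrite eq_le sq.1/=.
pose I := {t : R | 0 <= t}.
(* The infimum over t >= 0 of q (z + t y) - t q(y) is sublinear and below q, so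
   it is q; the value t = 1 then bounds q(z) + q(y) by q (z + y). *)
pose Q (i : I) z := q (z + (sval i)%:C *: y) - sval i * q y.
have qZ (t : R) : 0 <= t -> q (t%:C *: y) = t * q y.
  rewrite le_eqVlt => /predU1P[<-|t0]; last exact: sublinearZ.
  by rewrite scale0r mul0r sublinear0.
have Qb i z : - q (- z) <= Q i z.
  rewrite /Q; have := sq.1 (z + (sval i)%:C *: y) (- z).
  rewrite addrAC subrr add0r (qZ _ (svalP i)).
  by move=> H; lra.
pose i0 : I := exist _ 0 (lexx _).
pose i1 : I := exist _ 1 ler01.
have sQ : sublinear (pointwise_inf Q).
  apply: (@sublinear_pointwise_inf _ i0 _ _ Qb) => [i j u v|i r z r0].
    have ij : 0 <= sval i + sval j := addr_ge0 (svalP i) (svalP j).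
    exists (exist _ (sval i + sval j) ij); rewrite /Q /= rmorphD/= scalerDl addrACA.
    by have := sq.1 (u + (sval i)%:C *: y) (v + (sval j)%:C *: y) => H; lra.
  have ri : 0 <= r * sval i by rewrite mulr_ge0 ?(ltW r0)//; exact: (svalP i).
  exists (exist _ (r * sval i) ri); rewrite /Q /= rmorphM/= -scalerA -scalerDr.
  by rewrite sublinearZ// mulrBr mulrA.
have Qq z : pointwise_inf Q z <= q z.
  apply: le_trans (pointwise_inf_le Qb i0 z) _.
  by rewrite /Q/= scale0r addr0 mul0r subr0.
have := pointwise_inf_le Qb i1 x.
rewrite (qmin _ sQ Qq) /Q/= scale1r mul1r => H; lra.
Qed.

End Sublinear.

(** A real-linear g is the real part of the complex functional
    x |-> g(x) - i g(ix). *)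
Lemma complexify (E : normedModType C) (g : E -> R) (k : R) :
  (forall x y, g (x + y) = g x + g y) ->
  (forall (r : R) x, g (r%:C *: x) = r * g x) ->
  (forall x, g x <= k * rnorm x) ->
  exists G : dual E, forall x, G x = g x +i* - g ('i *: x).
Proof.
move=> gD gZ gk.
have gN x : g (- x) = - g x by rewrite -scaleN1r -(rmorphN1 (real_complex R)) gZ mulN1r.
pose G x : C^o := g x +i* - g ('i *: x).
have lG : linear G.
  move=> [a b] x y; rewrite /G.
  have abE z : (a +i* b : C) *: z = a%:C *: z + b%:C *: ('i *: z).
    by rewrite scalerA -scalerDl; congr (_ *: _); rewrite [LHS]complexE mulrC.
  rewrite gD scalerDr gD abE gD !gZ scalerDr gD scalerA ['i * _]mulrC -scalerA.
  rewrite gZ scalerA ['i * _]mulrC -scalerA gZ scalerA -expr2 sqr_i scaleN1r gN.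
  apply/eqP; rewrite eq_complex/=; apply/andP; split; apply/eqP; ring.
have kG x : rnorm (G x) <= (k + k) * rnorm x.
  have gabs z : `|g z| <= k * rnorm z.
    by rewrite ler_norml gk andbT lerNl -gN -(rnormN z) gk.
  apply: le_trans (rnorm_le_ReIm _) _; rewrite /= normrN mulrDl lerD//.
  by apply: le_trans (gabs _) _; rewrite rnormZ rnorm_i mul1r.
by exists (mkdual (bounded_linear_rnorm lG kG)).
Qed.

(** Every additive function below x |-> inf_v (Re Phi(v) + |Phi| |x - j v|) is
    bounded by |Phi| |x| and, taking x = j v and x = - j v, restricts to Re Phi;
    its complexification extends Phi.  The bound 2 |Phi| that results is enough,
    as only existence of the extension matters. *)
Lemma hahn_banach (V E : normedModType C) (j : V -> E) :
  linear j -> (forall v, rnorm (j v) = rnorm v) ->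
  forall Phi : dual V, exists Psi : dual E, forall v, Psi (j v) = Phi v.
Proof.
move=> lj nj Phi; pose k := rnorm Phi.
pose Q v x := complex.Re (Phi v) + k * rnorm (x - j v).
have k0 : 0 <= k := rnorm_ge0 _.
have Qb v x : - (k * rnorm x) <= Q v x.
  have Phiv : - (k * rnorm v) <= complex.Re (Phi v).
    rewrite lerNl -raddfN/= -dualN; apply: le_trans (Re_le_rnorm _) _.
    by rewrite -(rnormN v); exact: dual_apply_le.
  have : k * rnorm v <= k * (rnorm x + rnorm (x - j v)).
    rewrite ler_wpM2l// -nj -[j v](subKr x).
    by rewrite (le_trans (rnormD _ _))// rnormN subKr.
  by rewrite /Q; lra.
have sQ : sublinear (pointwise_inf Q).
  apply: (@sublinear_pointwise_inf _ _ 0 _ _ Qb) => [u v x y|v r x r0].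
    exists (u + v); rewrite /Q dualD raddfD/= (linearD_of lj) opprD addrACA.
    rewrite [leRHS]addrACA lerD2l -mulrDr ler_wpM2l//; exact: rnormD.
  exists (r%:C *: v); rewrite /Q dualZ (linearZ_of lj) -scalerBr rnormZr.
  rewrite (gtr0_norm r0) mulrDr [k * (r * _)]mulrCA lerD2r.
  by case: (Phi v) => a b /=; rewrite mul0r subr0.
have [g sg [gQ gD]] := sublinear_additive_below sQ.
have gN x : g (- x) = - g x.
  by apply/eqP; rewrite -addr_eq0 -gD addNr sublinear0.
have gZ (r : R) x : g (r%:C *: x) = r * g x.
  have [r0|r0|->] := ltgtP r 0; last by rewrite scale0r mul0r sublinear0.
    rewrite -[r]opprK rmorphN scaleNr gN sublinearZ ?oppr_gt0//; ring.
  exact: sublinearZ.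
have gk x : g x <= k * rnorm x.
  apply: le_trans (gQ x) _; apply: le_trans (pointwise_inf_le Qb 0 x) _.
  by rewrite /Q dual0 (linear0_of lj) subr0 add0r.
have gj v : g (j v) = complex.Re (Phi v).
  have gle w : g (j w) <= complex.Re (Phi w).
    apply: le_trans (gQ _) _; apply: le_trans (pointwise_inf_le Qb w _) _.
    by rewrite /Q subrr rnorm0 mulr0 addr0.
  apply/eqP; rewrite eq_le gle/=.
  have := gle (- v); rewrite (linearN_of lj) gN dualN raddfN/=; lra.
have [G GE] := complexify gD gZ gk.
exists G => v; rewrite GE -(linearZ_of lj) !gj dualZ.
by case: (Phi v) => a b /=; rewrite mul0r mul1r sub0r opprK.
Qed.

End HahnBanach.

(** * Weak* continuous functionals and Goldstine's theorem *)

Section WeakStarFunctionals.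
Variable R : realType.
Local Notation C := R[i].
Implicit Types W E G : normedModType C.

(** Induction on the list: if some phi0 kills the tail but not w0, subtracting
    a multiple of the evaluation at w0 makes h vanish on the annihilator of the
    tail; otherwise w0 is redundant. *)
Lemma dual_span_kernels W (l : seq W) (h : dual W -> C^o) : linear h ->
  (forall phi : dual W, {in l, forall w, phi w = 0} -> h phi = 0) ->
  exists w : W, forall phi : dual W, h phi = phi w.
Proof.
elim: l h => [|w0 l IHl] h lh hl.
  by exists 0 => phi; rewrite dual0 hl.
have [[phi0 [phi0l phi0w]]|sep] := pselect (exists phi0 : dual W,
    {in l, forall w, phi0 w = 0} /\ phi0 w0 != 0); last first.
  apply: IHl => // phi phil; apply: hl => w; rewrite inE => /predU1P[->|/phil//].
  by apply: contrapT => /eqP phiw; apply: sep; exists phi.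
pose c : C := h phi0 / phi0 w0.
have [||w hw] := IHl (fun phi => h phi - c * phi w0 : C^o).
- move=> a f g; rewrite lh -[(a *: f + g) w0]/(a * f w0 + g w0).
  by rewrite scalerBr -[a *: (c * f w0)]/(a * (c * f w0)); ring.
- move=> phi phil.
  have : h (- (phi w0 / phi0 w0) *: phi0 + phi) = 0.
    apply: hl => w; rewrite -[LHS]/(- (phi w0 / phi0 w0) * phi0 w + phi w) inE.
    move=> /predU1P[->|wl]; first by field.
    by rewrite (phi0l _ wl) (phil _ wl) mulr0 add0r.
  rewrite lh -[_ *: _]/(- (phi w0 / phi0 w0) * h phi0) => h0.
  by rewrite -h0 /c; field.
exists (w + c *: w0) => phi; rewrite dualD dualZ -hw; ring.
Qed.

(** The weak* topology is coarse enough for the annihilators of finite sets to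
    form a filter converging to 0; so h is smaller than 1, hence zero, on one of
    them, and h is a combination of the corresponding evaluations. *)
Lemma sigma_continuous_functional W (h : dual W -> C^o) : linear h ->
  continuous (h : sigma_topology (@canonical_predual R W) -> C^o) ->
  exists w : W, forall phi : dual W, h phi = phi w.
Proof.
move=> lh ch.
pose U (l : seq W) := [set phi : dual W | {in l, forall w, phi w = 0}].
pose F := filter_from setT U.
have FF : Filter F.
  apply: filter_from_filter; first by exists [::].
  move=> l1 l2 _ _; exists (l1 ++ l2) => // phi phi12.
  by split=> w wl; apply: phi12; rewrite mem_cat wl ?orbT.
have F0 : (F : set_system (sigma_topology (@canonical_predual R W))) -->
    (0 : sigma_topology (@canonical_predual R W)).
  apply: cvg_to_sigma => _ [w _ <-]; apply/cvg_fmap_rnormP => e e0.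
  exists [:: w] => // phi /= /(_ w); rewrite inE eqxx => ->//.
  by rewrite -[X in X - _]/(0 : C) subrr rnorm0.
have : h @ F --> (h 0 : C^o).
  exact: (@cvg_comp _ _ _ id (h : sigma_topology _ -> C^o) F _ _ F0 (ch 0)).
move=> /cvg_fmap_rnormP/(_ 1 ltr01)[l _ hl].
apply: (@dual_span_kernels _ l) => // phi phil; apply/eqP/negPn/negP => h0.
have : rnorm (h 0 - h ((h phi)^-1 *: phi) : C^o) < 1.
  apply: hl => w wl; rewrite -[LHS]/((h phi)^-1 * phi w).
  by rewrite (phil _ wl) mulr0.
rewrite (linear0_of lh) (linearZ_of lh) sub0r rnormN.
rewrite -[_ *: _]/((h phi)^-1 * h phi) mulVf//.
by rewrite -(rmorph1 (real_complex R)) rnorm_real normr1 ltxx.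
Qed.

Lemma rnorm_subM_sqr (v d : C) (t : R) :
  rnorm (v - t%:C * d : C^o) ^+ 2 =
  rnorm (v : C^o) ^+ 2 - 2 * t * complex.Re (v^* * d) + t ^+ 2 * rnorm (d : C^o) ^+ 2.
Proof.
have sq (z : C) : rnorm (z : C^o) ^+ 2 = complex.Re z ^+ 2 + complex.Im z ^+ 2.
  by apply: complexI; rewrite rmorphXn/= rnormE add_Re2_Im2.
by rewrite !sq; case: v => v1 v2; case: d => d1 d2 /=; ring.
Qed.

Lemma rnorm_dual_le_Re E (f : dual E) (k : R) :
  (forall x, rnorm x <= 1 -> complex.Re (f x) <= k) -> rnorm f <= k.
Proof.
move=> fk.
have k0 : 0 <= k by have := fk 0; rewrite rnorm0 dual0; apply.
have fk1 x : rnorm x <= 1 -> rnorm (f x) <= k.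
  move=> x1; have [->|fx0] := eqVneq (f x) 0; first by rewrite rnorm0.
  have n0 : 0 < rnorm (f x : C^o).
    by rewrite lt_neqAle rnorm_ge0 andbT eq_sym; apply: contra_neq fx0; exact: rnorm_eq0.
  pose u : C := (rnorm (f x))^-1%:C * (f x)^*.
  have u1 : rnorm (u : C^o) = 1.
    rewrite rnormM rnorm_real ger0_norm ?invr_ge0 ?rnorm_ge0//.
    have -> : rnorm ((f x)^* : C^o) = rnorm (f x).
      by apply: complexI; rewrite !rnormE normcJ.
    by rewrite mulVf// gt_eqF.
  have ufx : u * f x = (rnorm (f x))%:C.
    rewrite /u -mulrA [_^* * _]mulrC -sqr_normc -(rnormE (f x : C^o)) -rmorphXn -rmorphM.
    by congr (_%:C); rewrite expr2 mulrA mulVf ?mul1r// gt_eqF.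
  have := fk (u *: x); rewrite dualZ ufx /=; apply.
  by rewrite rnormZ u1 mul1r.
apply: rnorm_dual_le => // x; have [x0|x0] := eqVneq (rnorm x) 0.
  by rewrite (rnorm_eq0 x0) dual0 !rnorm0 mulr0.
have xp : 0 < rnorm x by rewrite lt_neqAle eq_sym x0 rnorm_ge0.
rewrite -ler_pdivrMr//; have := fk1 ((rnorm x)^-1%:C *: x).
have nV : `|(rnorm x)^-1| = (rnorm x)^-1 by rewrite ger0_norm// invr_ge0 ltW.
by rewrite dualZ rnormZr nV rnormM rnorm_real nV mulVf// mulrC; exact.
Qed.

Lemma sum_dual_apply E (l : seq (dual E)) (F : dual E -> dual E) x :
  (\sum_(f <- l) F f : dual E) x = \sum_(f <- l) F f x.
Proof. by elim/big_rec2: _ => [//|f a b _ <-]. Qed.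

(** Minimal distance in place of separation of convex sets.  If the distance
    from (Psi f) to the values (f x) on the unit ball were positive, then
    g = sum of conj (Psi f - f a) f, at a nearly optimal a, would satisfy
    |g| < Re Psi(g), which contradicts |Psi| <= 1. *)
Lemma goldstine E (Psi : dual (dual E)) (l : seq (dual E)) (e : R) :
  rnorm Psi <= 1 -> 0 < e ->
  exists2 x, rnorm x <= 1 & {in l, forall f, rnorm (Psi f - f x : C^o) < e}.
Proof.
move=> Psi1 e0.
pose Q x := \sum_(f <- l) rnorm (Psi f - f x : C^o) ^+ 2.
suff [x x1 Qx] : exists2 x, rnorm x <= 1 & Q x < e ^+ 2.
  exists x => // f fl; rewrite -(ltr_pXn2r (ltn0Sn 1)) ?nnegrE ?rnorm_ge0 ?(ltW e0)//.
  apply: le_lt_trans Qx; rewrite /Q (big_rem f)//= lerDl.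
  by apply: sumr_ge0 => g _; rewrite exprn_ge0// rnorm_ge0.
pose S := [set Q x | x in [set x | rnorm x <= 1]].
have Sinf : has_inf S.
  split; first by exists (Q 0), 0 => //=; rewrite rnorm0.
  exists 0 => _ [x _ <-]; apply: sumr_ge0 => g _.
  by rewrite exprn_ge0// rnorm_ge0.
pose D := inf S.
suff D0 : D <= 0.
  have [_ [x x1 <-] Qx] := inf_adherent (exprn_gt0 2 e0) Sinf.
  by exists x => //; rewrite (lt_le_trans Qx)// -/D gerDr.
rewrite leNgt; apply/negP => D0.
have DQ x : rnorm x <= 1 -> D <= Q x.
  by move=> x1; apply: ge_inf; [exact: Sinf.2|exists x].
pose K := \sum_(f <- l) (2 * rnorm f) ^+ 2.
have K0 : 0 <= K.
  by apply: sumr_ge0 => f _; rewrite exprn_ge0// mulr_ge0 ?rnorm_ge0.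
have DK : 0 < D + K by rewrite ltr_wpDr.
(* Moving from a towards b by the proportion t changes Q by
   - 2 t Re g (b - a) up to t ^ 2 K.  With this t, and a optimal up to t D / 2,
   the two errors divided by 2 t sum to at most 3/4 D, which stays below D. *)
pose t := D / (D + K).
have t0 : 0 < t by rewrite divr_gt0.
have t1 : t <= 1 by rewrite ler_pdivrMr// mul1r lerDl.
have tK : t * K <= D.
  by rewrite /t mulrAC ler_pdivrMr// ler_wpM2l ?(ltW D0)// lerDr ltW.
have [|_ [a a1 <-] Qa] := @inf_adherent _ S (t * D / 2) _ Sinf.
  by rewrite divr_gt0// mulr_gt0.
have {}a1 : rnorm a <= 1 := a1.
pose g : dual E := \sum_(f <- l) (Psi f - f a)^* *: f.
have gE x : g x = \sum_(f <- l) (Psi f - f a)^* * f x.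
  by rewrite /g sum_dual_apply.
have PsigE : Psi g = \sum_(f <- l) (Psi f - f a)^* * Psi f.
  rewrite /g; elim/big_rec2: _ => [|f b c _ <-]; first exact: dual0.
  by rewrite dualD dualZ.
have gnorm : rnorm g <= complex.Re (g a) + 3 / 4 * D.
  apply: rnorm_dual_le_Re => b b1.
  pose d := b - a.
  have at1 : rnorm (a + t%:C *: d) <= 1.
    have -> : a + t%:C *: d = (1 - t)%:C *: a + t%:C *: b.
      by rewrite /d rmorphB rmorph1 scalerBl scale1r scalerBr addrA addrAC.
    rewrite (le_trans (rnormD _ _))// !rnormZr !ger0_norm ?subr_ge0 ?(ltW t0)//.
    have : t * rnorm b <= t by rewrite ler_piMr// ltW.
    have : (1 - t) * rnorm a <= 1 - t by rewrite ler_piMr// subr_ge0.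
    lra.
  have QE : Q (a + t%:C *: d) =
      Q a - 2 * t * complex.Re (g d) + t ^+ 2 * \sum_(f <- l) rnorm (f d : C^o) ^+ 2.
    rewrite /Q gE raddf_sum/= !mulr_sumr -sumrB -big_split/=.
    apply: eq_bigr => f _; rewrite dualD dualZ opprD addrA.
    exact: rnorm_subM_sqr.
  have dK : \sum_(f <- l) rnorm (f d : C^o) ^+ 2 <= K.
    apply: ler_sum => f _; rewrite lerXn2r ?nnegrE ?mulr_ge0 ?rnorm_ge0//.
    apply: le_trans (dual_apply_le _ _) _; rewrite mulrC ler_wpM2r ?rnorm_ge0//.
    rewrite (le_trans (rnormD _ _))// rnormN; lra.
  have := DQ _ at1; rewrite QE /d dualB raddfB/= => DQt.
  have : t ^+ 2 * (\sum_(f <- l) rnorm (f d : C^o) ^+ 2) <= t * D.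
    rewrite expr2 -mulrA ler_wpM2l ?(ltW t0)//.
    by apply: le_trans tK; rewrite ler_wpM2l ?(ltW t0).
  move: Qa; rewrite -/D => Qa sqd.
  have : 2 * t * (complex.Re (g b) - complex.Re (g a)) <= 2 * t * (3 / 4 * D).
    have -> : 2 * t * (3 / 4 * D) = t * D / 2 + t * D by field.
    rewrite /d in DQt sqd; lra.
  have t2 : 0 < 2 * t by rewrite mulr_gt0.
  by rewrite (ler_pM2l t2) lerBlDl.
have Psig : complex.Re (Psi g) <= complex.Re (g a) + 3 / 4 * D.
  apply: le_trans (Re_le_rnorm _) _; apply: le_trans (dual_apply_le _ _) _.
  by apply: le_trans gnorm; rewrite ler_piMl ?rnorm_ge0.
have QaE : complex.Re (Psi g) - complex.Re (g a) = Q a.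
  rewrite PsigE gE -raddfB -sumrB raddf_sum; apply: eq_bigr => f _ /=.
  by rewrite -mulrBr mulrC -sqr_normc -(rnormE (Psi f - f a : C^o)) -rmorphXn/=.
have := DQ a a1; lra.
Qed.

End WeakStarFunctionals.

(** * The iterated-extension criterion for weak compactness *)

Section Transpose.
Variable R : realType.
Local Notation C := R[i].
Implicit Types E G H : normedModType C.

Lemma bl_adjoint E G (T : E -> G) (bT : bounded_linear T) :
  bounded_linear (adjoint bT).
Proof.
have [_ [k k0 Tk]] := bounded_linear_bound bT.
apply: (@bounded_linear_rnorm _ _ _ _ k) => [c f g|f]; first exact: dual_ext.
apply: rnorm_dual_le => [|x]; first by rewrite mulr_ge0// rnorm_ge0.
apply: le_trans (dual_apply_le f (T x)) _; rewrite mulrAC [leRHS]mulrC.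
by rewrite ler_wpM2l ?rnorm_ge0.
Qed.

Lemma bl_bidual E : bounded_linear (@bidual_embedding R E).
Proof.
apply: (@bounded_linear_rnorm _ _ _ _ 1) => [c x y|x].
  by apply: dual_ext => f; rewrite /= dualD dualZ.
rewrite mul1r; apply: rnorm_dual_le => [|f]; first exact: rnorm_ge0.
by rewrite mulrC; exact: (dual_apply_le f x).
Qed.

(** The other way to read T as a bilinear form on E and G. *)
Definition transpose E G (T : E -> dual G) (bT : bounded_linear T) (y : G) :
  dual E := adjoint bT (bidual_embedding y).

Lemma bl_transpose E G (T : E -> dual G) (bT : bounded_linear T) :
  bounded_linear (transpose bT).
Proof. exact: bounded_linear_comp (bl_adjoint bT) (bl_bidual G). Qed.

(** Goldstine's theorem for all functionals at once, in the form of a filter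
    on the unit ball converging weak* to Psi. *)
Lemma goldstine_filter E (Psi : dual (dual E)) : rnorm Psi <= 1 ->
  exists F : set_system E, [/\ ProperFilter F, F [set x | `|x| <= 1] &
    forall f : dual E, (f : E -> C^o) @ F --> (Psi f : C^o)].
Proof.
move=> Psi1.
pose U (p : seq (dual E) * R) := [set x : E | rnorm x <= 1 /\
  {in p.1, forall f, rnorm (Psi f - f x : C^o) < p.2}].
pose F := filter_from [set p : seq (dual E) * R | 0 < p.2] U.
have FF : Filter F.
  apply: filter_from_filter; first by exists ([::], 1) => /=.
  move=> [l1 e1] [l2 e2] /= e10 e20; exists (l1 ++ l2, Num.min e1 e2).
    by rewrite /= lt_min e10.
  move=> x [x1 /= xl]; split; split=> //= f fl; have := xl f;
    by rewrite mem_cat fl ?orbT => /(_ isT); rewrite lt_min => /andP[].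
have PF : ProperFilter F.
  apply: filter_from_proper => -[l e] /= e0.
  by have [x x1 xl] := goldstine l Psi1 e0; exists x.
exists F; split=> // [|f].
  by exists ([::], 1) => //= x [x1 _]; rewrite /= rnorm_le1.
apply/cvg_fmap_rnormP => e e0; exists ([:: f], e) => //= x [_]; apply.
by rewrite inE.
Qed.

Lemma dual_scale1 E (Psi : dual (dual E)) : exists r : R, 0 < r /\
  rnorm (r%:C *: Psi) <= 1.
Proof.
exists (rnorm Psi + 1)^-1; have n0 : 0 < rnorm Psi + 1 by rewrite ltr_wpDl ?rnorm_ge0.
split; first by rewrite invr_gt0.
by rewrite rnormZr gtr0_norm ?invr_gt0// mulrC ler_pdivrMr// mul1r lerDl.
Qed.

(** The iterated-extension criterion, a form of Gantmacher's theorem.  If T is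
    weakly compact, push a filter on the unit ball converging to Psi through T:
    it clusters weakly at some e, and testing e against evaluations identifies it
    with x |-> Psi (a |-> T a x).  Conversely the identity says that
    Psi |-> (x |-> Psi (a |-> T a x)) is continuous from the weak* to the weak
    topology, so it maps the ball of the bidual onto a compact set, which contains
    the image of the ball under T. *)
Lemma weakly_compactP E G (T : E -> dual G) (bT : bounded_linear T) :
  weakly_compact T <-> forall (Psi : dual (dual E)) (y : dual (dual G)),
    Psi (adjoint bT y) = y (adjoint (bl_transpose bT) Psi).
Proof.
split=> [[K TK [cK _]] Psi y|TP].
  suff ball1 (Phi : dual (dual E)) : rnorm Phi <= 1 ->
      Phi (adjoint bT y) = y (adjoint (bl_transpose bT) Phi).
    have [r [r0 rPsi]] := dual_scale1 Psi.
    have := ball1 _ rPsi.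
    have -> : adjoint (bl_transpose bT) (r%:C *: Psi) =
      r%:C *: adjoint (bl_transpose bT) Psi by exact: dual_ext.
    rewrite dualZ -[LHS]/(r%:C * Psi (adjoint bT y)); apply: mulfI.
    by rewrite gt_eqF// ltcR.
  move=> Phi1; have [F [PF F1 FPhi]] := goldstine_filter Phi1.
  have FK : F (T @^-1` K) by apply: filterS F1 => x x1; apply: TK; exists x.
  have [e [_ cle]] := cK (T @ F) _ FK.
  (* The cluster value of z along the filter is both z e and the limit. *)
  have eE (z : dual (dual G)) : z e = Phi (adjoint bT z).
    apply/eqP; rewrite -subr_eq0; apply/eqP/(@rnorm_eq0 _ C^o)/eqP.
    rewrite eq_le rnorm_ge0 andbT; apply/ler_addgt0Pr => d d0; rewrite add0r.
    have d2 : 0 < d / 2 by rewrite divr_gt0.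
    have /cvg_fmap_rnormP/(_ _ d2) Fz := FPhi (adjoint bT z).
    have Fz' : (T @ F) [set u | rnorm (Phi (adjoint bT z) - z u : C^o) < d / 2] := Fz.
    have /cvg_fmap_rnormP/(_ _ d2) Ne := @sigma_eval_continuous _ _ setT z I e.
    have [u /= [u1 u2]] := cle _ _ Fz' Ne.
    have -> : z e - Phi (adjoint bT z) = (z e - z u) - (Phi (adjoint bT z) - z u).
      by ring.
    rewrite (le_trans (rnormD _ _))// rnormN [leRHS](splitr d).
    by apply: lerD; exact: ltW.
  rewrite -eE; congr (y _); apply: dual_ext => m.
  exact: (eE (bidual_embedding m)).
pose S (Psi : dual (dual E)) := adjoint (bl_transpose bT) Psi.
apply: (@precompact_sub_compact (weak (dual G)) _
  (S @` [set Psi | rnorm Psi <= 1])).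
  move=> _ [x /= x1 <-]; exists (bidual_embedding x); last exact: dual_ext.
  apply: rnorm_dual_le => // f; rewrite mul1r.
  apply: le_trans (dual_apply_le f x) _.
  by rewrite ler_piMr ?rnorm_ge0// -rnorm_le1.
apply: continuous_compact (@banach_alaoglu _ (dual E) 1).
apply: continuous_subspaceT; apply: continuous_to_sigma => y _.
have -> : (fun Psi => y (S Psi) : C^o) = (fun Psi => Psi (adjoint bT y)).
  by apply/funext => Psi; rewrite TP.
apply: (@sigma_eval_continuous _ _ _ (bidual_embedding (adjoint bT y))).
by exists (adjoint bT y).
Qed.

(** The criterion is symmetric in the two variables of the bilinear form. *)
Lemma weakly_compact_transpose E G (T : E -> dual G) (bT : bounded_linear T) :
  weakly_compact T -> weakly_compact (transpose bT).
Proof.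
move=> /(weakly_compactP bT) TP; apply/(weakly_compactP (bl_transpose bT)) => y Psi.
rewrite -TP; congr (Psi _); apply: dual_ext => x /=.
by congr (y _); exact: dual_ext.
Qed.

End Transpose.

(** * Coefficient functions and Arens actions *)

Section Coefficients.
Variable R : realType.
Local Notation C := R[i].
Variables (B : normedModType C) (mul : B -> B -> B).
Variables (X : normedModType C) (s : bimodule mul X).

Lemma lact_rnorm : exists2 k : R, 0 <= k &
  forall b x, rnorm (lact s b x) <= k * rnorm b * rnorm x.
Proof.
have [k lk] := lact_bounded s; exists `|k| => // b x.
apply: (@le_trans _ _ (k * rnorm b * rnorm x)).
  by rewrite -lecR !rmorphM/= !rnormE.
by rewrite !ler_wpM2r ?rnorm_ge0// ler_norm.
Qed.

Lemma ract_rnorm : exists2 k : R, 0 <= k &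
  forall b x, rnorm (ract s x b) <= k * rnorm b * rnorm x.
Proof.
have [k lk] := ract_bounded s; exists `|k| => // b x.
apply: (@le_trans _ _ (k * rnorm b * rnorm x)).
  by rewrite -lecR !rmorphM/= !rnormE mulrAC.
by rewrite !ler_wpM2r ?rnorm_ge0// ler_norm.
Qed.

Lemma bl_lorbit x : bounded_linear (lact s ^~ x).
Proof.
have [k k0 lk] := lact_rnorm.
apply: (@bounded_linear_rnorm _ _ _ _ (k * rnorm x)) => [|b].
  exact: lact_linearl.
by rewrite mulrAC.
Qed.

Lemma bl_rorbit x : bounded_linear (ract s x).
Proof.
have [k k0 rk] := ract_rnorm.
apply: (@bounded_linear_rnorm _ _ _ _ (k * rnorm x)) => [|b].
  exact: ract_linearr.
by rewrite mulrAC.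
Qed.

Definition lcoef (x : X) (f : dual X) : dual B := adjoint (bl_lorbit x) f.
Definition rcoef (x : X) (f : dual X) : dual B := adjoint (bl_rorbit x) f.

Lemma lcoef_rnorm (k : R) : 0 <= k ->
  (forall b x, rnorm (lact s b x) <= k * rnorm b * rnorm x) ->
  forall x f, rnorm (lcoef x f) <= k * rnorm x * rnorm f.
Proof.
move=> k0 lk x f; apply: rnorm_dual_le => [|b]; first by rewrite !mulr_ge0 ?rnorm_ge0.
apply: le_trans (dual_apply_le f (lact s b x)) _.
by rewrite [leRHS]mulrC mulrA [leRHS]mulrC ler_wpM2l ?rnorm_ge0// mulrA [rnorm b * k]mulrC.
Qed.

Lemma rcoef_rnorm (k : R) : 0 <= k ->
  (forall b x, rnorm (ract s x b) <= k * rnorm b * rnorm x) ->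
  forall x f, rnorm (rcoef x f) <= k * rnorm x * rnorm f.
Proof.
move=> k0 rk x f; apply: rnorm_dual_le => [|b]; first by rewrite !mulr_ge0 ?rnorm_ge0.
apply: le_trans (dual_apply_le f (ract s x b)) _.
by rewrite [leRHS]mulrC mulrA [leRHS]mulrC ler_wpM2l ?rnorm_ge0// mulrA [rnorm b * k]mulrC.
Qed.

Lemma bl_lcoef f : bounded_linear (lcoef ^~ f).
Proof.
have [k k0 lk] := lact_rnorm.
apply: (@bounded_linear_rnorm _ _ _ _ (k * rnorm f)) => [c x y|x].
  by apply: dual_ext => b; rewrite /= lact_linearr dualD dualZ.
by rewrite mulrAC lcoef_rnorm.
Qed.

Lemma bl_rcoef f : bounded_linear (rcoef ^~ f).
Proof.
have [k k0 rk] := ract_rnorm.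
apply: (@bounded_linear_rnorm _ _ _ _ (k * rnorm f)) => [c x y|x].
  by apply: dual_ext => b; rewrite /= ract_linearl dualD dualZ.
by rewrite mulrAC rcoef_rnorm.
Qed.

(** The functional x |-> Phi (b |-> f (x . b)), that is Phi . f for Phi in
    the bidual of B. *)
Definition arens_lact (Phi : dual (dual B)) (f : dual X) : dual X :=
  adjoint (bl_rcoef f) Phi.
(** The functional x |-> Phi (b |-> f (b . x)), that is f . Phi. *)
Definition arens_ract (f : dual X) (Phi : dual (dual B)) : dual X :=
  adjoint (bl_lcoef f) Phi.

Lemma bl_arens_lact Phi : bounded_linear (arens_lact Phi).
Proof.
have [k k0 rk] := ract_rnorm.
apply: (@bounded_linear_rnorm _ _ _ _ (rnorm Phi * k)) => [c f g|f].
  apply: dual_ext => x; rewrite /= (_ : rcoef x _ = c *: rcoef x f + rcoef x g).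
    by rewrite dualD dualZ.
  exact: dual_ext.
apply: rnorm_dual_le => [|x]; first by rewrite !mulr_ge0 ?rnorm_ge0.
apply: le_trans (dual_apply_le Phi (rcoef x f)) _.
by rewrite -!mulrA ler_wpM2l ?rnorm_ge0// mulrA mulrAC rcoef_rnorm.
Qed.

Lemma bl_arens_ract Phi : bounded_linear (arens_ract ^~ Phi).
Proof.
have [k k0 lk] := lact_rnorm.
apply: (@bounded_linear_rnorm _ _ _ _ (rnorm Phi * k)) => [c f g|f].
  apply: dual_ext => x; rewrite /= (_ : lcoef x _ = c *: lcoef x f + lcoef x g).
    by rewrite dualD dualZ.
  exact: dual_ext.
apply: rnorm_dual_le => [|x]; first by rewrite !mulr_ge0 ?rnorm_ge0.
apply: le_trans (dual_apply_le Phi (lcoef x f)) _.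
by rewrite -!mulrA ler_wpM2l ?rnorm_ge0// mulrA mulrAC lcoef_rnorm.
Qed.

End Coefficients.

(** * Weakly almost periodic functionals *)

Section WeaklyAlmostPeriodic.
Variable R : realType.
Local Notation C := R[i].
Variables (B : normedModType C) (mul : B -> B -> B).
Variables (X : normedModType C) (s : bimodule mul X).
Local Notation s' := (dual_bimodule s).
Local Notation wap := (wap_pred (dual_bimodule s)).

Lemma wapP (f : dual X) : f \in wap <->
  forall (Phi : dual (dual B)) (y : dual (dual X)),
    Phi (lcoef s' f y) = y (arens_lact s Phi f) /\
    Phi (rcoef s' f y) = y (arens_ract s f Phi).
Proof.
have lE Phi : adjoint (bl_transpose (bl_lorbit s' f)) Phi = arens_lact s Phi f.
  by apply: dual_ext => x /=; congr (Phi _); exact: dual_ext.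
have rE Phi : adjoint (bl_transpose (bl_rorbit s' f)) Phi = arens_ract s f Phi.
  by apply: dual_ext => x /=; congr (Phi _); exact: dual_ext.
split=> [/asboolP[/(weakly_compactP (bl_lorbit s' f)) lf
                  /(weakly_compactP (bl_rorbit s' f)) rf] Phi y|H].
  by rewrite -lE -rE; split; [exact: lf|exact: rf].
apply/asboolP; split.
  by apply/(weakly_compactP (bl_lorbit s' f)) => Phi y; rewrite lE; exact: (H _ _).1.
by apply/(weakly_compactP (bl_rorbit s' f)) => Phi y; rewrite rE; exact: (H _ _).2.
Qed.

Lemma wap_arens_lact f (Phi : dual (dual B)) y : f \in wap ->
  Phi (lcoef s' f y) = y (arens_lact s Phi f).
Proof. by move=> /wapP/(_ Phi y)[]. Qed.

Lemma wap_arens_ract f (Phi : dual (dual B)) y : f \in wap ->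
  Phi (rcoef s' f y) = y (arens_ract s f Phi).
Proof. by move=> /wapP/(_ Phi y)[]. Qed.

(** The criterion [wapP] compares, for each Phi and y, two bounded functionals
    of f; their difference is a Z that kills WAP, so it kills f too.  This replaces
    the separation of f from a closed subspace, and gives its closedness. *)
Lemma wap_bipolar (f : dual X) :
  (forall Z : dual (dual X), (forall g, g \in wap -> Z g = 0) -> Z f = 0) ->
  f \in wap.
Proof.
move=> fZ; apply/wapP => Phi y; split.
  have b1 := bl_lcoef s' y; have b2 := bl_arens_lact s Phi.
  have /eqP : (adjoint b1 Phi - adjoint b2 y) f = 0.
    apply: fZ => g /wapP/(_ Phi y)[gl _].
    by rewrite -[LHS]/(Phi (lcoef s' g y) - y (arens_lact s Phi g)) gl subrr.
  by rewrite subr_eq0 => /eqP.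
have b1 := bl_rcoef s' y; have b2 := bl_arens_ract s Phi.
have /eqP : (adjoint b1 Phi - adjoint b2 y) f = 0.
  apply: fZ => g /wapP/(_ Phi y)[_ gr].
  by rewrite -[LHS]/(Phi (rcoef s' g y) - y (arens_ract s g Phi)) gr subrr.
by rewrite subr_eq0 => /eqP.
Qed.

(** Any Z that kills WAP kills T, and the criterion for T moves Z inside Phi. *)
Lemma wap_average (G : normedModType C) (T : G -> dual X) (bT : bounded_linear T)
    (Phi : dual (dual G)) :
  weakly_compact T -> (forall g, T g \in wap) ->
  adjoint (bl_transpose bT) Phi \in wap.
Proof.
move=> /(weakly_compactP bT) wT TW; apply: wap_bipolar => Z Z0.
rewrite -wT (_ : adjoint bT Z = 0) ?dual0//.
by apply: dual_ext => g; rewrite /= Z0.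
Qed.

Lemma weakly_compact_lcoef f : f \in wap -> weakly_compact (lcoef s ^~ f).
Proof.
move=> /asboolP[_ rf]; have := weakly_compact_transpose (bl_rorbit s' f) rf.
by congr weakly_compact; apply/funext => x; exact: dual_ext.
Qed.

Lemma weakly_compact_rcoef f : f \in wap -> weakly_compact (rcoef s ^~ f).
Proof.
move=> /asboolP[lf _]; have := weakly_compact_transpose (bl_lorbit s' f) lf.
by congr weakly_compact; apply/funext => x; exact: dual_ext.
Qed.

Lemma wap_cvg (F : set_system (dual X)) (f : dual X) : ProperFilter F ->
  F --> f -> F [set g | g \in wap] -> f \in wap.
Proof.
move=> PF Ff FW; apply: wap_bipolar => Z Z0.
have FZ : (Z : dual X -> C^o) @ F --> (Z f : C^o).
  exact: (@cvg_comp _ _ _ id (Z : dual X -> C^o) F _ _ Ff (@dual_continuous _ _ Z f)).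
apply: (@rnorm_eq0 _ C^o); apply/eqP; rewrite eq_le rnorm_ge0 andbT.
apply/ler_addgt0Pr => e e0; rewrite add0r.
have /cvg_fmap_rnormP/(_ e e0) Fe := FZ.
have [g /= [ge gW]] := filter_ex (filterI Fe FW).
by move: ge; rewrite (Z0 _ gW) subr0 => /ltW.
Qed.

End WeaklyAlmostPeriodic.

(** * Stability of weak almost periodicity *)

Section CoefficientsAreWAP.
Variables (R : realType) (A : banachAlgebra R).
Local Notation C := R[i].
Local Notation wapA := (wap_pred (dual_bimodule (regular A))).
Variables (X : normedModType C) (s : bimodule (@ba_mul R A) X).
Local Notation s' := (dual_bimodule s).
Local Notation wap := (wap_pred (dual_bimodule s)).

(** For g = lcoef x f the orbits are b . g = lcoef (b . x) f and
    g . b = lcoef x (f . b): a bounded map followed by the transpose of an orbit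
    of f, and an orbit of f followed by a bounded map. *)
Lemma wap_lcoef x f : f \in wap -> lcoef s x f \in wapA.
Proof.
move=> fW; apply/asboolP; split.
  have -> : lact (dual_bimodule (regular A)) ^~ (lcoef s x f) =
      (lcoef s ^~ f) \o (lact s ^~ x).
    by apply/funext => b; apply: dual_ext => a /=; rewrite lact_mul.
  apply: weakly_compact_pre (weakly_compact_lcoef fW); last exact: bl_lorbit.
  exact: (bl_lcoef s f).1.
have -> : ract (dual_bimodule (regular A)) (lcoef s x f) =
    adjoint (bl_lorbit s x) \o ract s' f.
  by apply/funext => b; apply: dual_ext => a /=; rewrite lact_mul.
apply: weakly_compact_post; first exact: bl_adjoint.
by have /asboolP[] := fW.
Qed.

Lemma wap_rcoef x f : f \in wap -> rcoef s x f \in wapA.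
Proof.
move=> fW; apply/asboolP; split.
  have -> : lact (dual_bimodule (regular A)) ^~ (rcoef s x f) =
      adjoint (bl_rorbit s x) \o lact s' ^~ f.
    by apply/funext => b; apply: dual_ext => a /=; rewrite ract_mul.
  apply: weakly_compact_post; first exact: bl_adjoint.
  by have /asboolP[] := fW.
have -> : ract (dual_bimodule (regular A)) (rcoef s x f) =
    (rcoef s ^~ f) \o ract s x.
  by apply/funext => b; apply: dual_ext => a /=; rewrite ract_mul.
apply: weakly_compact_pre (weakly_compact_rcoef fW); last exact: bl_rorbit.
exact: (bl_rcoef s f).1.
Qed.

(** The function a |-> y (a . f) is the y-average of x |-> rcoef x f, which is
    weakly compact with values in WAP by [wap_rcoef]. *)
Lemma wap_lcoef_dual f y : f \in wap -> lcoef s' f y \in wapA.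
Proof.
move=> fW; rewrite (_ : lcoef s' f y = adjoint (bl_transpose (bl_rcoef s f)) y).
  apply: wap_average => [|x]; first exact: weakly_compact_rcoef.
  exact: wap_rcoef.
by apply: dual_ext => a /=; congr (y _); exact: dual_ext.
Qed.

Lemma wap_rcoef_dual f y : f \in wap -> rcoef s' f y \in wapA.
Proof.
move=> fW; rewrite (_ : rcoef s' f y = adjoint (bl_transpose (bl_lcoef s f)) y).
  apply: wap_average => [|x]; first exact: weakly_compact_lcoef.
  exact: wap_lcoef.
by apply: dual_ext => a /=; congr (y _); exact: dual_ext.
Qed.

(** Phi . f is the Phi-average of the orbit a |-> a . f, which stays in WAP. *)
Lemma wap_arens_lact_closed Phi f : f \in wap -> arens_lact s Phi f \in wap.
Proof.
move=> fW; rewrite (_ : arens_lact s Phi f = adjoint (bl_transpose (bl_lorbit s' f)) Phi).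
  apply: wap_average => [|a]; first by have /asboolP[] := fW.
  exact: (wap_lact_subproof a (Wap fW)).
by apply: dual_ext => a /=; congr (Phi _); exact: dual_ext.
Qed.

Lemma wap_arens_ract_closed Phi f : f \in wap -> arens_ract s f Phi \in wap.
Proof.
move=> fW; rewrite (_ : arens_ract s f Phi = adjoint (bl_transpose (bl_rorbit s' f)) Phi).
  apply: wap_average => [|a]; first by have /asboolP[] := fW.
  exact: (wap_ract_subproof (Wap fW) a).
by apply: dual_ext => a /=; congr (Phi _); exact: dual_ext.
Qed.

End CoefficientsAreWAP.

(** * The product of the enveloping dual Banach algebra *)

Section EnvelopingAlgebra.
Variables (R : realType) (A : banachAlgebra R).
Local Notation C := R[i].
Local Notation regA := (dual_bimodule (regular A)).
Local Notation wapA := (wap_pred (dual_bimodule (regular A))).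
Local Notation FA := (enveloping_algebra A).
Local Notation q := (enveloping_quotient (regular A)).

Lemma enveloping_quotient_surj (Phi : FA) : exists Psi, q Psi = Phi.
Proof.
have [Psi PsiE] := @hahn_banach R _ _ _ (bl_wap_val (dual_bimodule (regular A))).1
  (fun=> erefl) Phi.
by exists Psi; exact: dual_ext.
Qed.

(** Lifts allow F(A) to be handled through the Arens actions of the bidual of A;
    on WAP the choice of lift is immaterial, see [enveloping_liftE]. *)
Definition enveloping_lift (Phi : FA) : dual (dual A) :=
  projT1 (cid (enveloping_quotient_surj Phi)).

Lemma enveloping_liftK Phi : q (enveloping_lift Phi) = Phi.
Proof. by rewrite /enveloping_lift; case: cid. Qed.

Lemma enveloping_liftE Phi f (fW : f \in wapA) :
  enveloping_lift Phi f = Phi (Wap fW).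
Proof. by rewrite -[in RHS](enveloping_liftK Phi). Qed.

Lemma arensE (Phi Psi : dual (dual A)) f :
  arens Phi Psi f = Phi (rcoef regA f Psi).
Proof. by rewrite /=; congr (Phi _); exact: dual_ext. Qed.

(** On WAP the first Arens product coincides with the second one. *)
Lemma arens_wap (Phi Psi : dual (dual A)) f : f \in wapA ->
  arens Phi Psi f = Psi (arens_ract (regular A) f Phi).
Proof. by move=> fW; rewrite arensE wap_arens_ract. Qed.

(** The Arens product descends to F(A): its value at f in WAP only involves
    Phi on the function a |-> Psi (f . a), and Psi on the functionals f . a, which
    are all in WAP. *)
Lemma enveloping_mulE (Phi Psi : dual (dual A)) :
  q (arens Phi Psi) = enveloping_mul A (q Phi) (q Psi).
Proof.
rewrite /enveloping_mul; case: xgetP => [m _ -> //|nom].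
exfalso; apply: (nom (fun P Q => q (arens (enveloping_lift P) (enveloping_lift Q)))) => {}Phi {}Psi.
have quot (P Q : dual (dual A)) f : q P = q Q -> f \in wapA -> P f = Q f.
  by move=> PQ fW; rewrite -[LHS]/(q P (Wap fW)) PQ.
apply: dual_ext => -[f fW]; rewrite -[LHS]/(arens Phi Psi f).
rewrite -[RHS]/(arens (enveloping_lift (q Phi)) (enveloping_lift (q Psi)) f) !arensE.
rewrite (quot (enveloping_lift (q Phi)) Phi) ?enveloping_liftK//; last first.
  exact: wap_rcoef_dual.
congr (Phi _); apply: dual_ext => a /=; apply: quot.
  by rewrite enveloping_liftK.
exact: (wap_ract_subproof (Wap fW) a).
Qed.

Lemma enveloping_mul_lift (Phi Psi : FA) f (fW : f \in wapA) :
  enveloping_mul A Phi Psi (Wap fW) = arens (enveloping_lift Phi) (enveloping_lift Psi) f.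
Proof.
by rewrite -[in LHS](enveloping_liftK Phi) -[in LHS](enveloping_liftK Psi)
  -enveloping_mulE.
Qed.

Lemma eta_algebraM (a b : A) :
  eta_algebra (ba_mul A a b) = enveloping_mul A (eta_algebra a) (eta_algebra b).
Proof. by rewrite -enveloping_mulE; exact: dual_ext. Qed.

Lemma bl_eta_algebra : bounded_linear (@eta_algebra R A).
Proof. exact: bounded_linear_comp (bl_adjoint _) (bl_bidual A). Qed.

End EnvelopingAlgebra.

(** * The enveloping module as a normal module over F(A) *)

Section EnvelopingAction.
Variables (R : realType) (A : banachAlgebra R).
Local Notation C := R[i].
Local Notation FA := (enveloping_algebra A).
Local Notation mulF := (enveloping_mul A).
Local Notation lift := (@enveloping_lift R A).
Variables (X : normedModType C) (s : bimodule (@ba_mul R A) X).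
Local Notation s' := (dual_bimodule s).
Local Notation W := (WAP (dual_bimodule s)).

Definition envelop_lact (Phi : FA) (w : W) : W :=
  Wap (wap_arens_lact_closed (lift Phi) (wap_valP w)).
Definition envelop_ract (w : W) (Phi : FA) : W :=
  Wap (wap_arens_ract_closed (lift Phi) (wap_valP w)).

Lemma envelop_lactE Phi w x :
  wap_val (envelop_lact Phi w) x = Phi (Wap (wap_rcoef x (wap_valP w))).
Proof. by rewrite -enveloping_liftE. Qed.

Lemma envelop_ractE Phi w x :
  wap_val (envelop_ract w Phi) x = Phi (Wap (wap_lcoef x (wap_valP w))).
Proof. by rewrite -enveloping_liftE. Qed.

Lemma wap_ext (v w : W) : (forall x, wap_val v x = wap_val w x) -> v = w.
Proof. by move=> vw; apply/val_inj/dual_ext. Qed.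

Lemma wap_linE (c : C) (v w : W) x :
  wap_val (c *: v + w) x = c * wap_val v x + wap_val w x.
Proof. exact: (congr1 (fun f : dual X => f x) ((bl_wap_val s').1 c v w)). Qed.

Lemma envelop_lact_linearr Phi : linear (envelop_lact Phi).
Proof. by move=> c v w; apply/val_inj; exact: (bl_arens_lact s (lift Phi)).1. Qed.

Lemma envelop_lact_linearl w : linear (envelop_lact ^~ w).
Proof.
move=> c Phi Psi; apply: wap_ext => x; rewrite envelop_lactE wap_linE.
by rewrite (envelop_lactE Phi) (envelop_lactE Psi).
Qed.

Lemma envelop_ract_linearl Phi : linear (envelop_ract ^~ Phi).
Proof. by move=> c v w; apply/val_inj; exact: (bl_arens_ract s (lift Phi)).1. Qed.

Lemma envelop_ract_linearr w : linear (envelop_ract w).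
Proof.
move=> c Phi Psi; apply: wap_ext => x; rewrite envelop_ractE wap_linE.
by rewrite (envelop_ractE Phi) (envelop_ractE Psi).
Qed.

Lemma envelop_lact_mul Phi Psi w :
  envelop_lact (mulF Phi Psi) w = envelop_lact Phi (envelop_lact Psi w).
Proof.
apply: wap_ext => x; rewrite envelop_lactE enveloping_mul_lift.
rewrite -[RHS]/(lift Phi (rcoef s x (arens_lact s (lift Psi) (val w)))) arensE.
congr (lift Phi _); apply: dual_ext => a /=; congr (lift Psi _).
by apply: dual_ext => b /=; rewrite ract_mul.
Qed.

(** Unlike the left action, the right action respects the product only because
    the two Arens products agree on the coefficient functions. *)
Lemma envelop_ract_mul w Phi Psi :
  envelop_ract w (mulF Phi Psi) = envelop_ract (envelop_ract w Phi) Psi.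
Proof.
apply: wap_ext => x; rewrite envelop_ractE enveloping_mul_lift.
rewrite -[RHS]/(lift Psi (lcoef s x (arens_ract s (val w) (lift Phi)))).
rewrite arens_wap; last exact: wap_lcoef (wap_valP w).
congr (lift Psi _); apply: dual_ext => b /=; congr (lift Phi _).
by apply: dual_ext => a /=; rewrite lact_mul.
Qed.

(** The two actions commute by the criterion for w itself, applied to the
    functional f |-> Phi (rcoef x f). *)
Lemma envelop_lract Phi w Psi :
  envelop_ract (envelop_lact Phi w) Psi = envelop_lact Phi (envelop_ract w Psi).
Proof.
apply: wap_ext => x.
rewrite -[LHS]/(lift Psi (lcoef s x (arens_lact s (lift Phi) (val w)))).
rewrite -[RHS]/(lift Phi (rcoef s x (arens_ract s (val w) (lift Psi)))).
have bl : bounded_linear (rcoef s x) := bl_adjoint _.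
rewrite -[RHS]/(adjoint bl (lift Phi) (arens_ract s (val w) (lift Psi))).
rewrite -wap_arens_ract; last exact: (wap_valP w).
congr (lift Psi _); apply: dual_ext => a /=; congr (lift Phi _).
by apply: dual_ext => b /=; rewrite lract.
Qed.

Lemma envelop_lact_rnorm (k : R) : 0 <= k ->
  (forall a x, rnorm (ract s x a) <= k * rnorm a * rnorm x) ->
  forall Phi w, rnorm (envelop_lact Phi w) <= k * rnorm Phi * rnorm w.
Proof.
move=> k0 rk Phi w; apply: rnorm_dual_le => [|x]; first by rewrite !mulr_ge0 ?rnorm_ge0.
rewrite envelop_lactE; apply: le_trans (dual_apply_le _ _) _.
rewrite [k * _]mulrC -!mulrA ler_wpM2l ?rnorm_ge0//.
by rewrite [rnorm w * _]mulrC mulrA; exact: rcoef_rnorm.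
Qed.

Lemma envelop_ract_rnorm (k : R) : 0 <= k ->
  (forall a x, rnorm (lact s a x) <= k * rnorm a * rnorm x) ->
  forall Phi w, rnorm (envelop_ract w Phi) <= k * rnorm Phi * rnorm w.
Proof.
move=> k0 lk Phi w; apply: rnorm_dual_le => [|x]; first by rewrite !mulr_ge0 ?rnorm_ge0.
rewrite envelop_ractE; apply: le_trans (dual_apply_le _ _) _.
rewrite [k * _]mulrC -!mulrA ler_wpM2l ?rnorm_ge0//.
by rewrite [rnorm w * _]mulrC mulrA; exact: lcoef_rnorm.
Qed.

Lemma envelop_lact_bounded : exists k : R, forall Phi w,
  `|envelop_lact Phi w| <= k%:C * `|Phi| * `|w|.
Proof.
have [k k0 rk] := ract_rnorm s; exists k => Phi w.
rewrite -!rnormE -!rmorphM lecR; exact: envelop_lact_rnorm.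
Qed.

Lemma envelop_ract_bounded : exists k : R, forall w Phi,
  `|envelop_ract w Phi| <= k%:C * `|w| * `|Phi|.
Proof.
have [k k0 lk] := lact_rnorm s; exists k => w Phi.
rewrite -!rnormE -!rmorphM lecR mulrAC; exact: envelop_ract_rnorm.
Qed.

Lemma wap_complete (F : set_system W) : ProperFilter F -> cauchy F -> cvg F.
Proof.
move=> PF /cauchy_rnormP cF.
pose G := (val : W -> dual X) @ F.
have cG : cauchy G.
  apply/cauchy_rnormP => e e0; have [w Fw] := cF e e0.
  by exists (val w).
have /cvg_ex[f Gf] : cvg G by exact: dual_complete.
have fW : f \in wap_pred (dual_bimodule s).
  by apply: wap_cvg Gf _; apply: (@filterE _ F) => w; exact: wap_valP.
apply/cvg_ex; exists (Wap fW); apply/cvg_rnormP => e e0.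
by have /cvg_rnormP/(_ e e0) := Gf.
Qed.

HB.instance Definition _ := Uniform_isComplete.Build W wap_complete.

Definition envelop_bimodule : bimodule mulF W :=
  Bimodule envelop_lact_linearr envelop_lact_linearl envelop_ract_linearl
    envelop_ract_linearr envelop_lact_mul envelop_ract_mul envelop_lract
    envelop_lact_bounded envelop_ract_bounded.

(** For y extending x, the functional Phi |-> (Phi . x)(w) = Phi (a |-> y (w . a))
    is the evaluation at an element of WAP of the dual of A. *)
Lemma envelop_bimodule_normal :
  normal_dual (@enveloping_algebra_predual R A) envelop_bimodule.
Proof.
move=> x.
have [y yE] := @hahn_banach R _ _ _ (bl_wap_val (dual_bimodule s)).1 (fun=> erefl) x.
split; apply: continuous_to_sigma => _ [w _ <-].
  have -> : (fun b : FA => bidual_embedding w (lact (dual_bimodule envelop_bimodule) b x) : C^o)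
      = bidual_embedding (Wap (wap_rcoef_dual y (wap_valP w))).
    apply/funext => b /=; rewrite -yE /= -wap_arens_ract; last exact: wap_valP.
    exact: enveloping_liftE.
  by apply: sigma_eval_continuous; exists (Wap (wap_rcoef_dual y (wap_valP w))).
have -> : (fun b : FA => bidual_embedding w (ract (dual_bimodule envelop_bimodule) x b) : C^o)
    = bidual_embedding (Wap (wap_lcoef_dual y (wap_valP w))).
  apply/funext => b /=; rewrite -yE /= -wap_arens_lact; last exact: wap_valP.
  exact: enveloping_liftE.
by apply: sigma_eval_continuous; exists (Wap (wap_lcoef_dual y (wap_valP w))).
Qed.

Lemma envelop_bimodule_contractive :
  contractive s -> contractive (dual_bimodule envelop_bimodule).
Proof.
move=> [ls rs].
have ls1 a x : rnorm (lact s a x) <= 1 * rnorm a * rnorm x.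
  by rewrite mul1r -lecR rmorphM/= !rnormE.
have rs1 a x : rnorm (ract s x a) <= 1 * rnorm a * rnorm x.
  by rewrite mul1r -lecR rmorphM/= !rnormE.
split=> [Phi x|x Phi]; rewrite -!rnormE -rmorphM lecR;
  apply: rnorm_dual_le => [|w]; rewrite ?mulr_ge0 ?rnorm_ge0//.
  apply: le_trans (dual_apply_le x (envelop_ract w Phi)) _.
  rewrite mulrAC [leRHS]mulrC ler_wpM2l ?rnorm_ge0// -[rnorm Phi]mul1r.
  exact: envelop_ract_rnorm.
apply: le_trans (dual_apply_le x (envelop_lact Phi w)) _.
rewrite mulrAC [leRHS]mulrC ler_wpM2l ?rnorm_ge0// -[rnorm Phi]mul1r.
exact: envelop_lact_rnorm.
Qed.

Lemma envelop_lact_eta a (x : dual W) :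
  lact (dual_bimodule envelop_bimodule) (eta_algebra a) x =
  lact (enveloping_bimodule s) a x.
Proof.
apply: dual_ext => w /=; congr (x _); apply: wap_ext => m.
by rewrite envelop_ractE.
Qed.

Lemma envelop_ract_eta a (x : dual W) :
  ract (dual_bimodule envelop_bimodule) x (eta_algebra a) =
  ract (enveloping_bimodule s) x a.
Proof.
apply: dual_ext => w /=; congr (x _); apply: wap_ext => m.
by rewrite envelop_lactE.
Qed.

Lemma bl_eta : bounded_linear (eta s).
Proof. exact: bounded_linear_comp (bl_adjoint _) (bl_bidual X). Qed.

Lemma eta_lact a x : eta s (lact s a x) = lact (enveloping_bimodule s) a (eta s x).
Proof. exact: dual_ext. Qed.

Lemma eta_ract a x : eta s (ract s x a) = ract (enveloping_bimodule s) (eta s x) a.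
Proof. exact: dual_ext. Qed.

End EnvelopingAction.

(** The map eta D is a derivation of A into the normal dual F(A)-bimodule
    F_A(M). *)
Lemma derivations_to_envelope (R : realType) (A : banachAlgebra R) :
  (forall (N : completeNormedModType R[i])
      (s : bimodule (enveloping_mul A) N),
      normal_dual (enveloping_algebra_predual A) s ->
      contractive (dual_bimodule s) ->
    forall D : A -> dual N,
      let l := fun (a : A) x => lact (dual_bimodule s) (eta_algebra a) x in
      let r := fun x (a : A) => ract (dual_bimodule s) x (eta_algebra a) in
      derivation (ba_mul A) l r D -> inner l r D) ->
    forall (M : completeNormedModType R[i]) (s : bimodule (ba_mul A) M),
      contractive s ->
    forall D : A -> M, derivation (ba_mul A) (lact s) (ract s) D ->
      inner (lact (enveloping_bimodule s)) (ract (enveloping_bimodule s))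
        (fun a : A => eta s (D a)).
Proof.
move=> iii M s cs D [bD DM].
have [|n Dn] := iii _ (envelop_bimodule s) (@envelop_bimodule_normal _ _ _ s)
    (envelop_bimodule_contractive cs) (fun a => eta s (D a)).
- split; first exact: bounded_linear_comp (bl_eta s) bD.
  move=> a b; rewrite envelop_lact_eta envelop_ract_eta -eta_lact -eta_ract.
  by rewrite DM (linearD_of (bl_eta s).1).
- by exists n => a; rewrite Dn envelop_lact_eta envelop_ract_eta.
Qed.


(** * Derivations into normal dual modules *)

Section NormalModules.
Variables (R : realType) (A : banachAlgebra R).
Local Notation C := R[i].
Local Notation FA := (enveloping_algebra A).
Local Notation mulF := (enveloping_mul A).
Local Notation q := (enveloping_quotient (regular A)).
Variables (N : normedModType C) (s : bimodule mulF N).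

Definition eta_lact_fun (a : A) (x : N) : N := lact s (eta_algebra a) x.
Definition eta_ract_fun (x : N) (a : A) : N := ract s x (eta_algebra a).

Lemma rnorm_eta_algebra (a : A) : rnorm (eta_algebra a) <= rnorm a.
Proof.
apply: rnorm_dual_le => [|w]; first exact: rnorm_ge0.
by rewrite mulrC; exact: (dual_apply_le (wap_val w) a).
Qed.

Lemma eta_lact_bounded : exists k : R, forall (a : A) x,
  `|eta_lact_fun a x| <= k%:C * `|a| * `|x|.
Proof.
have [k k0 lk] := lact_rnorm s; exists k => a x.
rewrite -!rnormE -!rmorphM lecR (le_trans (lk _ _))// ler_wpM2r ?rnorm_ge0//.
by rewrite ler_wpM2l// rnorm_eta_algebra.
Qed.

Lemma eta_ract_bounded : exists k : R, forall x (a : A),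
  `|eta_ract_fun x a| <= k%:C * `|x| * `|a|.
Proof.
have [k k0 rk] := ract_rnorm s; exists k => x a.
rewrite -!rnormE -!rmorphM lecR (le_trans (rk _ _))// mulrAC ler_wpM2l ?mulr_ge0 ?rnorm_ge0//.
exact: rnorm_eta_algebra.
Qed.

Definition pullback : bimodule (@ba_mul R A) N.
Proof.
refine (@Bimodule R A (@ba_mul R A) N eta_lact_fun eta_ract_fun _ _ _ _ _ _ _
  eta_lact_bounded eta_ract_bounded).
- by move=> a; exact: lact_linearr.
- by move=> x c a b; rewrite /eta_lact_fun (bl_eta_algebra A).1 lact_linearl.
- by move=> a; exact: ract_linearl.
- by move=> x c a b; rewrite /eta_ract_fun (bl_eta_algebra A).1 ract_linearr.
- by move=> a b x; rewrite /eta_lact_fun eta_algebraM lact_mul.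
- by move=> x a b; rewrite /eta_ract_fun eta_algebraM ract_mul.
- by move=> a x b; exact: lract.
Defined.

Hypothesis sN : normal_dual (@enveloping_algebra_predual R A) s.

Lemma normal_lact_predual x (f : dual N) :
  exists w, forall b : FA, f (lact s b x) = b w.
Proof.
apply: (@sigma_continuous_functional _ _ (fun b : FA => f (lact s b x) : C^o)).
  by move=> c a b; rewrite lact_linearl dualD dualZ.
have [_ cr] := sN f => b.
exact: (continuous_comp (cr b) (@sigma_eval_continuous _ _ (@canonical_predual R N)
  (bidual_embedding x) (ex_intro2 _ _ x I erefl) _)).
Qed.

Lemma normal_ract_predual x (f : dual N) :
  exists w, forall b : FA, f (ract s x b) = b w.
Proof.
apply: (@sigma_continuous_functional _ _ (fun b : FA => f (ract s x b) : C^o)).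
  by move=> c a b; rewrite ract_linearr dualD dualZ.
have [cl _] := sN f => b.
exact: (continuous_comp (cl b) (@sigma_eval_continuous _ _ (@canonical_predual R N)
  (bidual_embedding x) (ex_intro2 _ _ x I erefl) _)).
Qed.

(** Normality makes b |-> f (b . x) a point of the predual of F(A), so that
    extending it from A to the bidual is evaluating it at the image of Psi. *)
Lemma normal_lcoef (Psi : dual (dual A)) x (f : dual N) :
  Psi (lcoef pullback x f) = f (lact s (q Psi) x).
Proof.
have [w wE] := normal_lact_predual x f.
by rewrite wE; congr (Psi _); apply: dual_ext => a; rewrite /= /eta_lact_fun wE.
Qed.

Lemma normal_rcoef (Psi : dual (dual A)) x (f : dual N) :
  Psi (rcoef pullback x f) = f (ract s x (q Psi)).
Proof.
have [w wE] := normal_ract_predual x f.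
by rewrite wE; congr (Psi _); apply: dual_ext => a; rewrite /= /eta_ract_fun wE.
Qed.

Section Derivation.
Variable D : A -> dual N.
Hypothesis dD : derivation (ba_mul A)
  (fun (a : A) x => lact (dual_bimodule s) (eta_algebra a) x)
  (fun x (a : A) => ract (dual_bimodule s) x (eta_algebra a)) D.
Let bD : bounded_linear D := dD.1.
Let T : N -> dual A := transpose bD.

(** The product rule at (a, b), followed by the extension in b and then in a.
    The result is the same in the opposite order, see [derivation_arens_ract]: this
    is the weak almost periodicity of a |-> D a x, and also the product rule for the
    extension of D. *)
Lemma derivation_rcoef x (Phi Psi : dual (dual A)) :
  Phi (rcoef (dual_bimodule (regular A)) (T x) Psi) =
  Psi (T (ract s x (q Phi))) + Phi (T (lact s (q Psi) x)).
Proof.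
have -> : rcoef (dual_bimodule (regular A)) (T x) Psi =
    rcoef pullback x (adjoint (bl_transpose bD) Psi) + T (lact s (q Psi) x).
  apply: dual_ext => a.
  rewrite -[RHS]/(Psi (T (eta_ract_fun x a)) + D a (lact s (q Psi) x)).
  rewrite -normal_lcoef -dualD; congr (Psi _); apply: dual_ext => b.
  by rewrite -[LHS]/(D (ba_mul A a b) x) dD.2.
by rewrite dualD normal_rcoef.
Qed.

Lemma derivation_arens_ract x (Phi Psi : dual (dual A)) :
  Psi (arens_ract (regular A) (T x) Phi) =
  Psi (T (ract s x (q Phi))) + Phi (T (lact s (q Psi) x)).
Proof.
have -> : arens_ract (regular A) (T x) Phi =
    T (ract s x (q Phi)) + lcoef pullback x (adjoint (bl_transpose bD) Phi).
  apply: dual_ext => b.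
  rewrite -[RHS]/(D b (ract s x (q Phi)) + Phi (T (eta_lact_fun b x))).
  rewrite -normal_rcoef -dualD; congr (Phi _); apply: dual_ext => a.
  by rewrite -[LHS]/(D (ba_mul A a b) x) dD.2.
by rewrite dualD normal_lcoef.
Qed.

Lemma derivation_wap x : T x \in wap_pred (dual_bimodule (regular A)).
Proof.
apply/wapP => Phi Psi; split; last by rewrite derivation_rcoef derivation_arens_ract.
have -> : lcoef (dual_bimodule (regular A)) (T x) Psi =
    arens_ract (regular A) (T x) Psi.
  by apply: dual_ext => a /=; congr (Psi _); exact: dual_ext.
have -> : arens_lact (regular A) Phi (T x) =
    rcoef (dual_bimodule (regular A)) (T x) Phi.
  by apply: dual_ext => a /=; congr (Phi _); exact: dual_ext.
by rewrite derivation_rcoef derivation_arens_ract.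
Qed.

Definition derivation_predual (x : N) : WAP (dual_bimodule (regular A)) :=
  Wap (derivation_wap x).

Lemma bl_derivation_predual : bounded_linear derivation_predual.
Proof.
have [lT [k k0 Tk]] := bounded_linear_bound (bl_transpose bD).
apply: (@bounded_linear_rnorm _ _ _ _ k) => [c x y|x]; last exact: Tk.
by apply/val_inj; exact: lT.
Qed.

(** As the adjoint of a map into the predual, it is weak*-continuous. *)
Definition extend_derivation : FA -> dual N := adjoint bl_derivation_predual.

Lemma extend_derivation_eta a : extend_derivation (eta_algebra a) = D a.
Proof. exact: dual_ext. Qed.

Lemma extend_derivationP : derivation mulF (lact (dual_bimodule s))
  (ract (dual_bimodule s)) extend_derivation.
Proof.
split=> [|Phi Psi]; first exact: bl_adjoint.
apply: dual_ext => x.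
rewrite -[LHS]/(mulF Phi Psi (Wap (derivation_wap x))) enveloping_mul_lift arensE.
rewrite derivation_rcoef !enveloping_liftK.
by rewrite !(enveloping_liftE _ (derivation_wap _)).
Qed.

Lemma extend_derivation_continuous :
  sigma_continuous (@enveloping_algebra_predual R A) (@canonical_predual R N)
    extend_derivation.
Proof.
apply: continuous_to_sigma => _ [x _ <-].
apply: (@sigma_eval_continuous _ _ _ (bidual_embedding (derivation_predual x))).
by exists (derivation_predual x).
Qed.

End Derivation.
End NormalModules.

(** Every derivation of A into a normal dual F(A)-bimodule is the restriction of
    a weak*-continuous one of F(A). *)
Lemma Connes_amenable_derivations (R : realType) (A : banachAlgebra R) :
  Connes_amenable (enveloping_mul A) (enveloping_algebra_predual A) ->
  forall (N : completeNormedModType R[i])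
      (s : bimodule (enveloping_mul A) N),
      normal_dual (enveloping_algebra_predual A) s ->
    forall D : A -> dual N,
      let l := fun (a : A) x => lact (dual_bimodule s) (eta_algebra a) x in
      let r := fun x (a : A) => ract (dual_bimodule s) x (eta_algebra a) in
      derivation (ba_mul A) l r D -> inner l r D.
Proof.
move=> i N s sN D l r dD.
have [|n Dn] := i N s sN _ (extend_derivationP sN dD).
  exact: extend_derivation_continuous.
by exists n => a; rewrite -Dn extend_derivation_eta.
Qed.

(** * Renorming a bimodule *)

(** An alias of E that will carry the norm for which the bimodule is contractive;
    s is an argument because that norm depends on it. *)
Definition renormed (R : realType) (A : banachAlgebra R) (E : normedModType R[i])
  (s : bimodule (@ba_mul R A) E) : Type := E.

Section Renorm.
Variables (R : realType) (A : banachAlgebra R).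
Local Notation C := R[i].
Variables (E : normedModType C) (s : bimodule (@ba_mul R A) E).

HB.instance Definition _ := GRing.Lmodule.copy (renormed s) E.

(** None stands for the unit of the unitization of A. *)
Definition in_unit_ball (o : option A) := if o is Some a then rnorm a <= 1 else true.
Definition lact1 (o : option A) (x : E) : E := if o is Some a then lact s a x else x.
Definition ract1 (x : E) (o : option A) : E := if o is Some a then ract s x a else x.

Definition orbit_norms (x : E) : set R :=
  [set rnorm (ract1 (lact1 p.1 x) p.2) | p in
    [set p : option A * option A | in_unit_ball p.1 && in_unit_ball p.2]].

(** The supremum of |a . x . b| over the unit balls of A with units adjoined:
    the units make it dominate the norm, and the products of unit-ball elements
    being in the unit ball makes it contractive for both actions. *)
Definition orbit_norm (x : E) : R := sup (orbit_norms x).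

Lemma orbit_norms_bounded : exists2 K : R, 0 <= K & forall x,
  ubound (orbit_norms x) (K * rnorm x).
Proof.
have [k k0 lk] := lact_rnorm s; have [l l0 rl] := ract_rnorm s.
exists ((1 + l) * (1 + k)); first by rewrite mulr_ge0// addr_ge0.
have lact1_le o x : in_unit_ball o -> rnorm (lact1 o x) <= (1 + k) * rnorm x.
  case: o => [a /= a1|_ /=]; last by rewrite ler_peMl ?rnorm_ge0// lerDl.
  apply: le_trans (lk a x) _; rewrite ler_wpM2r ?rnorm_ge0//.
  by apply: le_trans (_ : k <= _); [rewrite ler_piMr|rewrite lerDr].
have ract1_le o x : in_unit_ball o -> rnorm (ract1 x o) <= (1 + l) * rnorm x.
  case: o => [a /= a1|_ /=]; last by rewrite ler_peMl ?rnorm_ge0// lerDl.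
  apply: le_trans (rl a x) _; rewrite ler_wpM2r ?rnorm_ge0//.
  by apply: le_trans (_ : l <= _); [rewrite ler_piMr|rewrite lerDr].
move=> x _ [[u v] /= /andP[u1 v1] <-].
apply: le_trans (ract1_le _ _ v1) _; rewrite -mulrA ler_wpM2l ?addr_ge0//.
exact: lact1_le.
Qed.

Lemma orbit_norm_le (x : E) (c : R) :
  (forall u v, in_unit_ball u -> in_unit_ball v ->
    rnorm (ract1 (lact1 u x) v) <= c) -> orbit_norm x <= c.
Proof.
move=> xc; apply: ge_sup; first by exists (rnorm x), (None, None).
by move=> _ [[u v] /= /andP[u1 v1] <-]; exact: xc.
Qed.

Lemma le_orbit_norm (x : E) u v : in_unit_ball u -> in_unit_ball v ->
  rnorm (ract1 (lact1 u x) v) <= orbit_norm x.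
Proof.
move=> u1 v1; have [K _ xK] := orbit_norms_bounded.
apply: ub_le_sup; first by exists (K * rnorm x); exact: xK.
by exists (u, v) => //=; rewrite u1.
Qed.

Lemma rnorm_le_orbit_norm x : rnorm x <= orbit_norm x.
Proof. exact: (@le_orbit_norm x None None). Qed.

Lemma orbit_norm_ge0 x : 0 <= orbit_norm x.
Proof. exact: le_trans (rnorm_ge0 x) (rnorm_le_orbit_norm x). Qed.

Lemma orbit_norm_bounded : exists2 K : R, 0 <= K & forall x,
  orbit_norm x <= K * rnorm x.
Proof.
have [K K0 xK] := orbit_norms_bounded; exists K => // x.
by apply: orbit_norm_le => u v u1 v1; apply: xK; exists (u, v) => //=; rewrite u1.
Qed.

Lemma ract1_lact1_linear u v : linear (fun x => ract1 (lact1 u x) v).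
Proof.
by case: u => [a|] c x y; case: v => [b|] //=;
  rewrite ?lact_linearr ?ract_linearl.
Qed.

Lemma orbit_normD x y : orbit_norm (x + y) <= orbit_norm x + orbit_norm y.
Proof.
apply: orbit_norm_le => u v u1 v1.
rewrite (linearD_of (ract1_lact1_linear u v)); apply: le_trans (rnormD _ _) _.
by apply: lerD; exact: le_orbit_norm.
Qed.

Lemma orbit_normZ_le (c : C) x :
  orbit_norm (c *: x) <= rnorm (c : C^o) * orbit_norm x.
Proof.
apply: orbit_norm_le => u v u1 v1.
rewrite (linearZ_of (ract1_lact1_linear u v)) rnormZ.
by rewrite ler_wpM2l ?rnorm_ge0//; exact: le_orbit_norm.
Qed.

Lemma orbit_normZ (c : C) x :
  orbit_norm (c *: x) = rnorm (c : C^o) * orbit_norm x.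
Proof.
apply/eqP; rewrite eq_le orbit_normZ_le/=.
have [->|c0] := eqVneq c 0; first by rewrite rnorm0 mul0r orbit_norm_ge0.
have nc0 : 0 < rnorm (c : C^o).
  by rewrite lt_neqAle rnorm_ge0 andbT eq_sym; apply: contra_neq c0; exact: rnorm_eq0.
have := orbit_normZ_le c^-1 (c *: x); rewrite scalerA mulVf// scale1r.
have -> : rnorm (c^-1 : C^o) = (rnorm (c : C^o))^-1.
  by apply: complexI; rewrite rnormE fmorphV/= rnormE normfV.
by rewrite ler_pdivlMl.
Qed.

Let norm (x : renormed s) : C := (orbit_norm x)%:C.

Let normD x y : norm (x + y) <= norm x + norm y.
Proof. by rewrite /norm -rmorphD lecR; exact: orbit_normD. Qed.

Let normZ (c : C) x : norm (c *: x) = `|c| * norm x.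
Proof.
by rewrite /norm -(rnormE (c : C^o)) -rmorphM; congr (_%:C); exact: orbit_normZ.
Qed.

Let norm_eq0 x : norm x = 0 -> x = 0.
Proof.
move=> /complexI x0; apply: (@rnorm_eq0 _ E); apply/eqP.
by rewrite eq_le rnorm_ge0 andbT -x0 rnorm_le_orbit_norm.
Qed.

HB.instance Definition _ :=
  Lmodule_isNormed.Build C (renormed s) normD normZ norm_eq0.

Definition to_renormed (x : E) : renormed s := x.
Definition of_renormed (x : renormed s) : E := x.

Lemma bl_to_renormed : bounded_linear to_renormed.
Proof.
have [K K0 xK] := orbit_norm_bounded.
by apply: (@bounded_linear_rnorm _ _ _ _ K).
Qed.

Lemma bl_of_renormed : bounded_linear of_renormed.
Proof.
by apply: (@bounded_linear_rnorm _ _ _ _ 1) => // x; rewrite mul1r rnorm_le_orbit_norm.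
Qed.

Lemma orbit_norm_lact a x : orbit_norm (lact s a x) <= rnorm a * orbit_norm x.
Proof.
have ball b : rnorm b <= 1 -> orbit_norm (lact s b x) <= orbit_norm x.
  move=> b1; apply: orbit_norm_le => -[c|] v /= c1 v1.
    rewrite -lact_mul; apply: (@le_orbit_norm x (Some (ba_mul A c b))) => //=.
    apply: (@le_trans _ _ (rnorm c * rnorm b)); last by rewrite mulr_ile1 ?rnorm_ge0.
    by rewrite -lecR rmorphM/= !rnormE ba_norm_mul.
  exact: (@le_orbit_norm x (Some b)).
have [a0|a0] := eqVneq (rnorm a) 0.
  rewrite (rnorm_eq0 a0) rnorm0 mul0r (linear0_of (lact_linearl s x)).
  by apply: orbit_norm_le => u v _ _; rewrite (linear0_of (ract1_lact1_linear u v)) rnorm0.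
have ap : 0 < rnorm a by rewrite lt_neqAle eq_sym a0 rnorm_ge0.
have := ball ((rnorm a)^-1%:C *: a).
rewrite rnormZr gtr0_norm ?invr_gt0// mulVf// => /(_ (lexx _)).
rewrite (linearZ_of (lact_linearl s x)) orbit_normZ rnorm_real gtr0_norm ?invr_gt0//.
by rewrite ler_pdivrMl.
Qed.

Lemma orbit_norm_ract x a : orbit_norm (ract s x a) <= rnorm a * orbit_norm x.
Proof.
have ball b : rnorm b <= 1 -> orbit_norm (ract s x b) <= orbit_norm x.
  move=> b1; apply: orbit_norm_le => u v u1.
  have -> : lact1 u (ract s x b) = ract s (lact1 u x) b.
    by case: u {u1} => [c|] //=; rewrite lract.
  case: v => [c|] /= c1.
    rewrite -ract_mul; apply: (@le_orbit_norm x u (Some (ba_mul A b c))) => //=.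
    apply: (@le_trans _ _ (rnorm b * rnorm c)); last by rewrite mulr_ile1 ?rnorm_ge0.
    by rewrite -lecR rmorphM/= !rnormE ba_norm_mul.
  exact: (@le_orbit_norm x u (Some b)).
have [a0|a0] := eqVneq (rnorm a) 0.
  rewrite (rnorm_eq0 a0) rnorm0 mul0r (linear0_of (ract_linearr s x)).
  by apply: orbit_norm_le => u v _ _; rewrite (linear0_of (ract1_lact1_linear u v)) rnorm0.
have ap : 0 < rnorm a by rewrite lt_neqAle eq_sym a0 rnorm_ge0.
have := ball ((rnorm a)^-1%:C *: a).
rewrite rnormZr gtr0_norm ?invr_gt0// mulVf// => /(_ (lexx _)).
rewrite (linearZ_of (ract_linearr s x)) orbit_normZ rnorm_real gtr0_norm ?invr_gt0//.
by rewrite ler_pdivrMl.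
Qed.

Lemma renormed_lact_le a (x : renormed s) :
  `|lact s a x : renormed s| <= `|a| * `|x|.
Proof. by rewrite -!rnormE -rmorphM lecR; exact: orbit_norm_lact. Qed.

Lemma renormed_ract_le (x : renormed s) a :
  `|ract s x a : renormed s| <= `|a| * `|x|.
Proof. by rewrite -!rnormE -rmorphM lecR; exact: orbit_norm_ract. Qed.

Definition renormed_bimodule : bimodule (@ba_mul R A) (renormed s).
Proof.
refine (@Bimodule R A (@ba_mul R A) (renormed s) (lact s) (ract s)
  (lact_linearr s) (lact_linearl s) (ract_linearl s) (ract_linearr s)
  (lact_mul s) (ract_mul s) (lract s) _ _).
  by exists 1 => b x; rewrite mul1r; exact: renormed_lact_le.
by exists 1 => x b; rewrite mul1r mulrC; exact: renormed_ract_le.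
Defined.

Lemma renormed_contractive : contractive renormed_bimodule.
Proof. by split; [exact: renormed_lact_le|exact: renormed_ract_le]. Qed.

End Renorm.

Section RenormComplete.
Variables (R : realType) (A : banachAlgebra R).
Local Notation C := R[i].
Variables (E : completeNormedModType C) (s : bimodule (@ba_mul R A) E).

(** The new norm is equivalent to the original one. *)
Lemma renormed_complete (F : set_system (renormed s)) :
  ProperFilter F -> cauchy F -> cvg F.
Proof.
move=> PF /cauchy_rnormP cF.
pose G := (@of_renormed R A E s) @ F.
have cG : cauchy G.
  apply/cauchy_rnormP => e e0; have [x Fx] := cF e e0; exists x.
  by apply: (@filterS _ F) Fx => y; apply: le_lt_trans; exact: rnorm_le_orbit_norm.
have /cvg_ex[x Gx] : cvg G by exact: cauchy_cvg.
apply/cvg_ex; exists x.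
exact: (cvg_comp _ _ Gx ((bl_to_renormed s).2 x)).
Qed.

HB.instance Definition _ :=
  Uniform_isComplete.Build (renormed s) renormed_complete.

End RenormComplete.

(** * Projection of the enveloping module onto a normal module *)

Section NormalEvaluations.
Variables (R : realType) (A : banachAlgebra R).
Local Notation C := R[i].
Local Notation FA := (enveloping_algebra A).
Local Notation mulF := (enveloping_mul A).
Local Notation q := (enveloping_quotient (regular A)).
Variables (N : normedModType C) (s : bimodule mulF N).
Hypothesis sN : normal_dual (@enveloping_algebra_predual R A) s.
Local Notation sA := (dual_bimodule (pullback s)).
Local Notation M := (renormed sA).
Local Notation sM := (renormed_bimodule sA).

Definition renormed_eval (x : N) : dual M :=
  adjoint (bl_of_renormed sA) (bidual_embedding x).

Lemma bl_renormed_eval : bounded_linear renormed_eval.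
Proof. exact: bounded_linear_comp (bl_adjoint _) (bl_bidual N). Qed.

(** For y in the bidual of the dual of M, z = y o eval is in N^*; the two sides of
    the criterion both become z (Psi . x), respectively z (x . Psi), by normality. *)
Lemma renormed_eval_wap x : renormed_eval x \in wap_pred (dual_bimodule sM).
Proof.
apply/wapP => Psi y; pose z : dual N := adjoint bl_renormed_eval y.
split.
  have -> : lcoef (dual_bimodule sM) (renormed_eval x) y = lcoef (pullback s) x z.
    by apply: dual_ext => a; rewrite /=; congr (y _); exact: dual_ext.
  rewrite (normal_lcoef sN) -[LHS]/(y (renormed_eval (lact s (q Psi) x))).
  congr (y _); apply: dual_ext => f.
  rewrite -[LHS]/((f : dual N) (lact s (q Psi) x)) -(normal_lcoef sN).
  by rewrite /=; congr (Psi _); exact: dual_ext.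
have -> : rcoef (dual_bimodule sM) (renormed_eval x) y = rcoef (pullback s) x z.
  by apply: dual_ext => a; rewrite /=; congr (y _); exact: dual_ext.
rewrite (normal_rcoef sN) -[LHS]/(y (renormed_eval (ract s x (q Psi)))).
congr (y _); apply: dual_ext => f.
rewrite -[LHS]/((f : dual N) (ract s x (q Psi))) -(normal_rcoef sN).
by rewrite /=; congr (Psi _); exact: dual_ext.
Qed.

Definition wap_eval (x : N) : WAP (dual_bimodule sM) := Wap (renormed_eval_wap x).

Lemma bl_wap_eval : bounded_linear wap_eval.
Proof.
have [lT [k k0 Tk]] := bounded_linear_bound bl_renormed_eval.
apply: (@bounded_linear_rnorm _ _ _ _ k) => [c x y|x]; last exact: Tk.
by apply/val_inj; exact: lT.
Qed.

Lemma wap_eval_ract x a :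
  ract (wap_bimodule (dual_bimodule sM)) (wap_eval x) a =
  wap_eval (ract s x (eta_algebra a)).
Proof. by apply/val_inj; exact: dual_ext. Qed.

Lemma wap_eval_lact a x :
  lact (wap_bimodule (dual_bimodule sM)) a (wap_eval x) =
  wap_eval (lact s (eta_algebra a) x).
Proof. by apply/val_inj; exact: dual_ext. Qed.

(** Restriction to N of functionals on WAP, a left inverse of eta on N^*. *)
Definition enveloping_proj (n : enveloping sM) : dual N :=
  adjoint bl_wap_eval n.

Lemma inner_enveloping_proj (D : A -> dual N) :
  inner (lact (enveloping_bimodule sM)) (ract (enveloping_bimodule sM))
    (fun a => eta sM (to_renormed sA (D a))) ->
  inner (fun a => lact (dual_bimodule s) (eta_algebra a))
    (fun f a => ract (dual_bimodule s) f (eta_algebra a)) D.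
Proof.
move=> [n Dn]; exists (enveloping_proj n) => a; apply: dual_ext => x.
have := congr1 (fun f : enveloping sM => f (wap_eval x)) (Dn a).
rewrite -[LHS]/(D a x) => ->.
rewrite -[LHS]/(n (ract (wap_bimodule (dual_bimodule sM)) (wap_eval x) a) -
  n (lact (wap_bimodule (dual_bimodule sM)) a (wap_eval x))).
by rewrite wap_eval_ract wap_eval_lact.
Qed.

(** At each x of N both sides of the identity are weak*-continuous in b, so they
    are given by elements of WAP, and these agree as functions on A. *)
Lemma inner_of_eta (D : FA -> dual N) : linear D ->
  sigma_continuous (@enveloping_algebra_predual R A) (@canonical_predual R N) D ->
  inner (fun a => lact (dual_bimodule s) (eta_algebra a))
    (fun f a => ract (dual_bimodule s) f (eta_algebra a)) (D \o @eta_algebra R A) ->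
  inner (lact (dual_bimodule s)) (ract (dual_bimodule s)) D.
Proof.
move=> lD cD [n Dn]; exists n => b; apply: dual_ext => x.
have [w0 w0E] : exists w, forall b : FA, D b x = b w.
  apply: (@sigma_continuous_functional _ _ (fun b : FA => D b x : C^o)).
    by move=> c b1 b2; rewrite lD.
  move=> b1; exact: (continuous_comp (cD b1) (@sigma_eval_continuous _ _
    (@canonical_predual R N) (bidual_embedding x) (ex_intro2 _ _ x I erefl) _)).
have [w1 w1E] := normal_ract_predual sN x n.
have [w2 w2E] := normal_lact_predual sN x n.
rewrite w0E -[RHS]/(n (ract s x b) - n (lact s b x)) w1E w2E -dualB; congr (b _).
apply/val_inj/dual_ext => a.
have := congr1 (fun f : dual N => f x) (Dn a).
rewrite -[LHS]/(D (eta_algebra a) x) w0E.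
by rewrite -[RHS]/(n (ract s x (eta_algebra a)) - n (lact s (eta_algebra a) x)) w1E w2E.
Qed.

End NormalEvaluations.

(** A derivation of F(A) is restricted to A, made inner in the enveloping module
    of the renormed N^*, projected back to N^*, and extended by continuity. *)
Lemma inner_in_envelopes_Connes_amenable (R : realType) (A : banachAlgebra R) :
  (forall (M : completeNormedModType R[i]) (s : bimodule (ba_mul A) M),
      contractive s ->
    forall D : A -> M, derivation (ba_mul A) (lact s) (ract s) D ->
      inner (lact (enveloping_bimodule s)) (ract (enveloping_bimodule s))
        (fun a : A => eta s (D a))) ->
  Connes_amenable (enveloping_mul A) (enveloping_algebra_predual A).
Proof.
move=> ii N s sN D [bD DM] cD.
apply: (inner_of_eta sN bD.1 cD); apply: inner_enveloping_proj => //.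
apply: (ii _ (renormed_bimodule (dual_bimodule (pullback s))) (renormed_contractive _)
  (fun a => to_renormed _ (D (eta_algebra a)))).
split.
  apply: bounded_linear_comp (bl_to_renormed _) _.
  exact: bounded_linear_comp bD (bl_eta_algebra A).
move=> a b; rewrite eta_algebraM DM.
by congr (_ + _); exact: dual_ext.
Qed.

Theorem theorem6p2 (R : realType) (A : banachAlgebra R) :
  let i := Connes_amenable (enveloping_mul A) (enveloping_algebra_predual A) in
  let ii :=
    forall (M : completeNormedModType R[i]) (s : bimodule (ba_mul A) M),
      contractive s ->
    forall D : A -> M, derivation (ba_mul A) (lact s) (ract s) D ->
      inner (lact (enveloping_bimodule s)) (ract (enveloping_bimodule s))
        (fun a : A => eta s (D a)) in
  let iii :=
    forall (N : completeNormedModType R[i])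
      (s : bimodule (enveloping_mul A) N),
      normal_dual (enveloping_algebra_predual A) s ->
      contractive (dual_bimodule s) ->
    forall D : A -> dual N,
      let l := fun (a : A) x => lact (dual_bimodule s) (eta_algebra a) x in
      let r := fun x (a : A) => ract (dual_bimodule s) x (eta_algebra a) in
      derivation (ba_mul A) l r D -> inner l r D in
  (i <-> ii) /\ (ii <-> iii).
Proof.
move=> i ii iii.
have i_iii : i -> iii by move=> Hi N s sN _; exact: Connes_amenable_derivations.
have iii_ii : iii -> ii := @derivations_to_envelope R A.
have ii_i : ii -> i := @inner_in_envelopes_Connes_amenable R A.
split; first by split=> [/i_iii/iii_ii|/ii_i].
by split=> [/ii_i/i_iii|/iii_ii].
Qed.
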